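(* Let $n\ge5$, let $\mathcal{G}=\{G_i \mid i\in\mathbb{Z}/n\mathbb{Z}\}$ be a collection of non-trivial groups, and let $X$ and $\mathscr{X}$ be the polygonal complexes associated to $C_n\mathcal{G}$ described in the context. Then the map $$X^{(0)} \to \mathscr{X}^{(0)}, \qquad gH \mapsto gHg^{-1}$$ (where $g\in C_n\mathcal{G}$ and $H=\langle G_i,G_{i+1}\rangle$ for some $i\in\mathbb{Z}/n\mathbb{Z}$) induces a $C_n\mathcal{G}$-equivariant isomorphism $\Phi: X\to\mathscr{X}$ of polygonal complexes.
   Context: The cyclic product $C_n\mathcal{G}$ is the quotient of the free product $\ast_{i} G_i$ by the relations $gh=hg$ for all $g\in G_i$, $h\in G_{i+1}$, $i \in \mathbb{Z}/n\mathbb{Z}$ (indices modulo $n$). Complex $X$: its vertices are the left cosets $g\langle G_i,G_{i+1}\rangle$ with $g\in C_n\mathcal{G}$, $i\in\mathbb{Z}/n\mathbb{Z}$; for every $g$ and $i$ there is an edge between $g\langle G_{i-1},G_i\rangle$ and $g\langle G_i,G_{i+1}\rangle$; and for every $g\in C_n\mathcal{G}$ there is an $n$-gon with boundary the $n$-cycle $g\langle G_1,G_2\rangle, g\langle G_2,G_3\rangle,\dots,g\langle G_n,G_1\rangle$. The group $C_n\mathcal{G}$ acts on $X$ by left multiplication. Complex $\mathscr{X}$: let $\mathcal{M}$ be the collection of maximal subgroups (with respect to inclusion) among the subgroups of $C_n\mathcal{G}$ which decompose non-trivially as direct products, and let $\mathcal{C}$ be the collection of non-trivial subgroups of $C_n\mathcal{G}$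 which can be obtained by intersecting two (possibly equal) subgroups of $\mathcal{M}$. A subgroup belonging to $\mathcal{C}$ is $\mathcal{C}$-minimal if it is minimal in $\mathcal{C}$ with respect to inclusion, $\mathcal{C}$-maximal if it is maximal in $\mathcal{C}$ with respect to inclusion (i.e. belongs to $\mathcal{M}$), and $\mathcal{C}$-medium otherwise. The vertices of $\mathscr{X}$ are the $\mathcal{C}$-medium subgroups; two vertices $H_1,H_2$ are linked by an edge if $\langle H_1,H_2\rangle$ is $\mathcal{C}$-maximal; and an $n$-gon is glued along each induced cycle of length exactly $n$ of the resulting graph. $C_n\mathcal{G}$ acts on $\mathscr{X}$ by the action induced by conjugation on vertices. *)

(* Defs.v *)
From HB Require Import structures.
From mathcomp Require Import all_boot all_order all_algebra.
From mathcomp Require Import mathcomp_extra boolp classical_sets.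

Set Implicit Arguments.
Unset Strict Implicit.
Unset Printing Implicit Defensive.

Import Algebra.

Local Open Scope quotient_scope.
Local Open Scope classical_set_scope.
Local Open Scope group_scope.

(* Indices in Z/nZ are elements of 'Z_n, which is Z/nZ only when 1 < n.       *)

Section CyclicProduct.
Variables (n : nat) (G : 'Z_n -> groupType).

Definition letter := {i : 'Z_n & G i}.
Definition mk_letter (i : 'Z_n) (x : G i) : letter := existT _ i x.
Definition inv_letter (l : letter) : letter := mk_letter (tagged l)^-1.

(* The congruence on words presenting C_n G: [cyc_one] and [cyc_mul] present  *)
(* the free product of the G_i, and [cyc_comm] adds the commutations between  *)
(* consecutive factors.                                                       *)
Inductive cyc_rel : seq letter -> seq letter -> Prop :=
| cyc_refl u : cyc_rel u u
| cyc_sym u v : cyc_rel u v -> cyc_rel v u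
| cyc_trans u v w : cyc_rel u v -> cyc_rel v w -> cyc_rel u w
| cyc_cat u u' v v' : cyc_rel u u' -> cyc_rel v v' -> cyc_rel (u ++ v) (u' ++ v')
| cyc_one (i : 'Z_n) : cyc_rel [:: mk_letter (1 : G i)] [::]
| cyc_mul (i : 'Z_n) (x y : G i) :
    cyc_rel [:: mk_letter x; mk_letter y] [:: mk_letter (x * y)]
| cyc_comm (i : 'Z_n) (x : G i) (y : G (i + 1)%R) :
    cyc_rel [:: mk_letter x; mk_letter y] [:: mk_letter y; mk_letter x].

Definition cyc_relb (u v : seq letter) : bool := `[< cyc_rel u v >].

Lemma cyc_relb_refl : reflexive cyc_relb.
Proof. by move=> u; apply/asboolP; apply: cyc_refl. Qed.

Lemma cyc_relb_sym : symmetric cyc_relb.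
Proof. by move=> u v; apply/asboolP/asboolP; apply: cyc_sym. Qed.

Lemma cyc_relb_trans : transitive cyc_relb.
Proof.
by move=> v u w /asboolP uv /asboolP vw; apply/asboolP; apply: cyc_trans uv vw.
Qed.

Canonical cyc_equiv := EquivRel cyc_relb cyc_relb_refl cyc_relb_sym cyc_relb_trans.

Definition cyclic_product := {eq_quot cyc_equiv}.
HB.instance Definition _ := Choice.on cyclic_product.
HB.instance Definition _ := EqQuotient.on cyclic_product.

Definition cyc_class (u : seq letter) : cyclic_product := \pi_cyclic_product u.
Definition cyc_word (a : cyclic_product) : seq letter := repr a.

Lemma cyc_classP u v : cyc_class u = cyc_class v <-> cyc_rel u v.
Proof. by split=> [/eqmodP/asboolP|?]; last by apply/eqmodP/asboolP. Qed.

Lemma cyc_wordK a : cyc_class (cyc_word a) = a.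
Proof. exact: reprK. Qed.

Lemma cyc_classK u : cyc_rel (cyc_word (cyc_class u)) u.
Proof. by apply/cyc_classP; rewrite cyc_wordK. Qed.

Definition inv_word (u : seq letter) := rev (map inv_letter u).

Lemma inv_word_cat u v : inv_word (u ++ v) = inv_word v ++ inv_word u.
Proof. by rewrite /inv_word map_cat rev_cat. Qed.

Lemma inv_wordK : involutive inv_word.
Proof.
move=> u; rewrite /inv_word map_rev revK -map_comp -[RHS]map_id.
by apply: eq_map => -[i x]; rewrite /= /inv_letter /= invgK.
Qed.

Lemma cyc_rel_mulV u : cyc_rel (u ++ inv_word u) [::].
Proof.
elim/last_ind: u => [|u [i x] IHu]; first exact: cyc_refl.
rewrite -cats1 inv_word_cat -catA (catA [:: _]).
apply: cyc_trans IHu; apply: cyc_cat; first exact: cyc_refl.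
rewrite -[X in cyc_rel _ X]cat0s; apply: cyc_cat; last exact: cyc_refl.
apply: cyc_trans (cyc_mul _ _) _.
by rewrite /= mulgV; apply: cyc_one.
Qed.

Lemma cyc_rel_Vmul u : cyc_rel (inv_word u ++ u) [::].
Proof. by rewrite -{2}(inv_wordK u); apply: cyc_rel_mulV. Qed.

Definition cyc_prod_mul (a b : cyclic_product) := cyc_class (cyc_word a ++ cyc_word b).
Definition cyc_prod_inv (a : cyclic_product) := cyc_class (inv_word (cyc_word a)).
Definition cyc_prod_one := cyc_class [::].

Lemma cyc_prod_mulA : associative cyc_prod_mul.
Proof.
move=> a b c; apply/cyc_classP.
apply: (@cyc_trans _ (cyc_word a ++ (cyc_word b ++ cyc_word c))).
  by apply: cyc_cat; [exact: cyc_refl | exact: cyc_classK].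
rewrite catA; apply: cyc_cat; last exact: cyc_refl.
exact/cyc_sym/cyc_classK.
Qed.

Lemma cyc_prod_mul1 : left_id cyc_prod_one cyc_prod_mul.
Proof.
move=> a; rewrite -[RHS]cyc_wordK; apply/cyc_classP.
rewrite -[X in cyc_rel _ X]cat0s.
by apply: cyc_cat; [exact: cyc_classK | exact: cyc_refl].
Qed.

Lemma cyc_prod_1mul : right_id cyc_prod_one cyc_prod_mul.
Proof.
move=> a; rewrite -[RHS]cyc_wordK; apply/cyc_classP.
rewrite -[X in cyc_rel _ X]cats0.
by apply: cyc_cat; [exact: cyc_refl | exact: cyc_classK].
Qed.

Lemma cyc_prod_mulVg : left_inverse cyc_prod_one cyc_prod_inv cyc_prod_mul.
Proof.
move=> a; apply/cyc_classP; apply: cyc_trans (cyc_rel_Vmul (cyc_word a)).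
by apply: cyc_cat; [exact: cyc_classK | exact: cyc_refl].
Qed.

Lemma cyc_prod_mulgV : right_inverse cyc_prod_one cyc_prod_inv cyc_prod_mul.
Proof.
move=> a; apply/cyc_classP; apply: cyc_trans (cyc_rel_mulV (cyc_word a)).
by apply: cyc_cat; [exact: cyc_refl | exact: cyc_classK].
Qed.

HB.instance Definition _ := isGroup.Build cyclic_product
  cyc_prod_mulA cyc_prod_mul1 cyc_prod_1mul cyc_prod_mulVg cyc_prod_mulgV.

(* The canonical morphism G_i -> C_n G. *)
Definition cyc_in (i : 'Z_n) (x : G i) : cyclic_product := cyc_class [:: mk_letter x].

End CyclicProduct.

Section Subgroups.
Variable C : groupType.
Implicit Types (g x y : C) (S T H K A B : set C).

Definition is_subgroup H := H 1 /\ forall x y, H x -> H y -> H (x / y).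

Definition trivial_subgroup : set C := [set 1].

(* The subgroup generated by S is [smallest is_subgroup S]. *)
Definition join_subgroup H K : set C := smallest is_subgroup (H `|` K).

Definition lcoset g S : set C := [set g * x | x in S].

(* g S g^-1 (the conjugation [S :^ x] of the library is on the other side). *)
Definition conj_set g S : set C := [set g * x / g | x in S].

Definition splits_as_product H :=
  is_subgroup H /\
  exists A B,
    [/\ is_subgroup A /\ is_subgroup B,
        A <> trivial_subgroup /\ B <> trivial_subgroup,
        forall x y, A x -> B y -> x * y = y * x,
        A `&` B = trivial_subgroup
      & H = [set x * y | x in A & y in B]].

Definition maximal_in (F : set (set C)) : set (set C) :=
  [set H | F H /\ forall K, F K -> H `<=` K -> K = H].

Definition minimal_in (F : set (set C)) : set (set C) :=
  [set H | F H /\ forall K, F K -> K `<=` H -> K = H].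

Definition max_products : set (set C) := maximal_in splits_as_product.

Definition coll_C : set (set C) :=
  [set H | H <> trivial_subgroup /\
     exists M1 M2, [/\ max_products M1, max_products M2 & H = M1 `&` M2]].

Definition C_minimal : set (set C) := minimal_in coll_C.
Definition C_maximal : set (set C) := maximal_in coll_C.
Definition C_medium : set (set C) :=
  [set H | [/\ coll_C H, ~ C_minimal H & ~ C_maximal H]].

Lemma lcoset1 S : lcoset 1 S = S.
Proof.
apply/seteqP; split=> [_ [y Sy <-]|x Sx]; first by rewrite mul1g.
by exists x; rewrite ?mul1g.
Qed.

Lemma lcosetM g h S : lcoset (g * h) S = lcoset g (lcoset h S).
Proof.
apply/seteqP; split=> [_ [y Sy <-]|_ [_ [y Sy <-] <-]].
  by exists (h * y); [exists y | rewrite mulgA].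
by exists y; rewrite ?mulgA.
Qed.

Lemma conj_set1 S : conj_set 1 S = S.
Proof.
apply/seteqP; split=> [_ [y Sy <-]|x Sx]; first by rewrite mul1g invg1 mulg1.
by exists x; rewrite ?mul1g ?invg1 ?mulg1.
Qed.

Lemma conj_setM g h S : conj_set (g * h) S = conj_set g (conj_set h S).
Proof.
apply/seteqP; split=> [_ [y Sy <-]|_ [_ [y Sy <-] <-]].
  by exists (h * y / h); [exists y | rewrite invgM !mulgA].
by exists y; rewrite ?invgM ?mulgA.
Qed.

Lemma conj_setK g : cancel (conj_set g) (conj_set g^-1).
Proof. by move=> S; rewrite -conj_setM mulVg conj_set1. Qed.

Lemma conj_setVK g : cancel (conj_set g^-1) (conj_set g).
Proof. by move=> S; rewrite -conj_setM mulgV conj_set1. Qed.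

Lemma conj_set_inj g : injective (conj_set g).
Proof. exact: can_inj (conj_setK g). Qed.

Lemma conj_elt_inj g : injective (fun x => g * x / g).
Proof. by move=> x y /mulIg /mulgI. Qed.

Lemma conj_setS g S T : S `<=` T -> conj_set g S `<=` conj_set g T.
Proof. exact: image_subset. Qed.

Lemma conj_setSE g S T : conj_set g S `<=` conj_set g T <-> S `<=` T.
Proof.
split; last exact: conj_setS.
by move=> /(@conj_setS g^-1); rewrite !conj_setK.
Qed.

Lemma conj_setI g S T : conj_set g (S `&` T) = conj_set g S `&` conj_set g T.
Proof.
apply/seteqP; split=> [_ [x [Sx Tx] <-]|_ [[x Sx <-] [y Ty]]].
  by split; exists x.
by move=> /conj_elt_inj yx; rewrite yx in Ty; exists x.
Qed.

Lemma conj_setU g S T : conj_set g (S `|` T) = conj_set g S `|` conj_set g T.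
Proof. exact: image_setU. Qed.

Lemma conj_trivial g : conj_set g trivial_subgroup = trivial_subgroup.
Proof. by rewrite /conj_set image_set1 mulg1 mulgV. Qed.

Lemma conj_nontrivial g S :
  conj_set g S <> trivial_subgroup <-> S <> trivial_subgroup.
Proof.
split=> ntS; first by move=> S1; apply: ntS; rewrite S1 conj_trivial.
by rewrite -(conj_trivial g) => /conj_set_inj.
Qed.

Lemma conj_eltM g x y : g * (x * y) / g = (g * x / g) * (g * y / g).
Proof. by rewrite !mulgA mulgVK. Qed.

Lemma conj_eltF g x y : g * (x / y) / g = (g * x / g) / (g * y / g).
Proof. by rewrite !invgM invgK !mulgA mulgVK. Qed.

Lemma conj_is_subgroup g H : is_subgroup H -> is_subgroup (conj_set g H).
Proof.
move=> [H1 HF]; split; first by exists 1; rewrite ?mulg1 ?mulgV.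
move=> _ _ [x Hx <-] [y Hy <-]; exists (x / y); first exact: HF.
exact: conj_eltF.
Qed.

Lemma conj_splits g H : splits_as_product H -> splits_as_product (conj_set g H).
Proof.
move=> [sgH [A [B [[sgA sgB] [ntA ntB] cAB tiAB defH]]]].
split; first exact: conj_is_subgroup.
exists (conj_set g A), (conj_set g B); split.
- by split; apply: conj_is_subgroup.
- by split; [exact: (conj_nontrivial g A).2 | exact: (conj_nontrivial g B).2].
- by move=> _ _ [x Ax <-] [y By <-]; rewrite -!conj_eltM (cAB x y).
- by rewrite -conj_setI tiAB conj_trivial.
rewrite defH; apply/seteqP; split=> [_ [_ [x Ax [y By <-]] <-]|].
  exists (g * x / g); first by exists x.
  by exists (g * y / g); [exists y | rewrite conj_eltM].
move=> _ [_ [x Ax <-] [_ [y By <-] <-]].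
by exists (x * y); [exists x => //; exists y | rewrite conj_eltM].
Qed.

Definition conj_stable (F : set (set C)) := forall g H, F H -> F (conj_set g H).

Lemma conj_stableV F g H : conj_stable F -> F (conj_set g H) -> F H.
Proof. by move=> sF /(sF g^-1); rewrite conj_setK. Qed.

Lemma conj_maximal F : conj_stable F -> conj_stable (maximal_in F).
Proof.
move=> sF g H [FH maxH]; split=> [|K FK HK]; first exact: sF.
rewrite -(conj_setVK g K); congr conj_set; apply: maxH; first exact: sF.
by apply/(conj_setSE g); rewrite conj_setVK.
Qed.

Lemma conj_minimal F : conj_stable F -> conj_stable (minimal_in F).
Proof.
move=> sF g H [FH minH]; split=> [|K FK HK]; first exact: sF.
rewrite -(conj_setVK g K); congr conj_set; apply: minH; first exact: sF.
by apply/(conj_setSE g); rewrite conj_setVK.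
Qed.

Lemma conj_coll_C : conj_stable coll_C.
Proof.
move=> g H [ntH [M1 [M2 [maxM1 maxM2 defH]]]].
have sM : conj_stable max_products by exact: conj_maximal conj_splits.
split; first exact: (conj_nontrivial g H).2.
exists (conj_set g M1), (conj_set g M2).
by rewrite -conj_setI -defH; split=> //; apply: sM.
Qed.

Lemma conj_C_maximal : conj_stable C_maximal.
Proof. by move=> g H; apply: conj_maximal; apply: conj_coll_C. Qed.

Lemma conj_C_minimal : conj_stable C_minimal.
Proof. by move=> g H; apply: conj_minimal; apply: conj_coll_C. Qed.

Lemma conj_C_medium : conj_stable C_medium.
Proof.
move=> g H [CH nminH nmaxH]; split; first exact: conj_coll_C.
  by move=> /(conj_stableV conj_C_minimal) /nminH.
by move=> /(conj_stableV conj_C_maximal) /nmaxH.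
Qed.

Lemma conj_join g H K :
  conj_set g (join_subgroup H K) = join_subgroup (conj_set g H) (conj_set g K).
Proof.
have sub h S T :
    join_subgroup (conj_set h S) (conj_set h T) `<=` conj_set h (join_subgroup S T).
  apply: smallest_sub; last first.
    by rewrite -conj_setU; apply: conj_setS; apply: sub_gen_smallest.
  apply: conj_is_subgroup; split=> [L [[]]//|x y Jx Jy L sL].
  by apply: (sL.1.2); [apply: Jx | apply: Jy].
apply/seteqP; split; last exact: sub.
apply/(conj_setSE g^-1); rewrite conj_setK.
by rewrite -{1}(conj_setK g H) -{1}(conj_setK g K); apply: sub.
Qed.

End Subgroups.

Section NgonComplexes.
Variable n : nat.

(* The parametrisations of the closed path c by 'Z_n that differ from c by    *)
(* a rotation or a reflection.                                                *)
Definition dihedral_class (V : Type) (c : 'Z_n -> V) : set ('Z_n -> V) :=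
  [set d | exists k : 'Z_n,
     (forall i, d i = c (i + k)%R) \/ (forall i, d i = c (k - i)%R)].

Lemma dihedral_class_map (V W : Type) (f : V -> W) (c : 'Z_n -> V) :
  [set f \o d | d in dihedral_class c] = dihedral_class (f \o c).
Proof.
apply/seteqP; split=> [_ [d [k dk] <-]|d [k [dk|dk]]].
- by exists k; case: dk => dk; [left | right] => i; rewrite /= dk.
- exists (fun i => c (i + k)%R); first by exists k; left.
  by apply/funext => i; rewrite dk.
- exists (fun i => c (k - i)%R); first by exists k; right.
  by apply/funext => i; rewrite dk.
Qed.

(* Polygonal complexes with simplicial 1-skeleton, all of whose polygons are  *)
(* n-gons. A polygon is glued along a closed edge-path of length n, recorded  *)
(* without base point or orientation; distinct polygons may a priori have the *)
(* same boundary.                                                             *)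
Record ngon_complex := NgonComplex {
  vertex : Type;
  adj : vertex -> vertex -> Prop;
  polygon : Type;
  boundary : polygon -> set ('Z_n -> vertex);
  adj_sym : forall v w, adj v w -> adj w v;
  boundaryP : forall p, exists c,
    (forall i, adj (c i) (c (i + 1)%R)) /\ boundary p = dihedral_class c
}.

Record complex_iso (K L : ngon_complex) := ComplexIso {
  vmap : vertex K -> vertex L;
  pmap : polygon K -> polygon L;
  vmap_bij : bijective vmap;
  pmap_bij : bijective pmap;
  adj_vmap : forall v w, adj (vmap v) (vmap w) <-> adj v w;
  boundary_pmap : forall p, boundary (pmap p) = [set vmap \o c | c in boundary p]
}.

Record complex_action (C : groupType) (K : ngon_complex) := ComplexAction {
  vact : C -> vertex K -> vertex K;
  pact : C -> polygon K -> polygon K;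
  vact1 : forall v, vact 1 v = v;
  pact1 : forall p, pact 1 p = p;
  vactM : forall g h v, vact (g * h) v = vact g (vact h v);
  pactM : forall g h p, pact (g * h) p = pact g (pact h p);
  vact_adj : forall g v w, adj v w -> adj (vact g v) (vact g w);
  boundary_pact : forall g p,
    boundary (pact g p) = [set vact g \o c | c in boundary p]
}.

Definition equivariant (C : groupType) (K L : ngon_complex)
    (aK : complex_action C K) (aL : complex_action C L) (f : complex_iso K L) :=
  (forall g v, vmap f (vact aK g v) = vact aL g (vmap f v)) /\
  (forall g p, pmap f (pact aK g p) = pact aL g (pmap f p)).

(* For 2 < n: c embeds the n-cycle as an induced subgraph. *)
Definition induced_cycle (V : Type) (e : V -> V -> Prop) (c : 'Z_n -> V) :=
  injective c /\
  forall i j, e (c i) (c j) <-> (j = i + 1)%R \/ (i = j + 1)%R.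

End NgonComplexes.

Section ComplexX.
Variables (n : nat) (G : 'Z_n -> groupType).
Local Notation C := (cyclic_product G).

(* <G_i, G_(i+1)> *)
Definition vertex_group (i : 'Z_n) : set C :=
  join_subgroup (range (@cyc_in n G i)) (range (@cyc_in n G (i + 1)%R)).

Definition X_vertices : set (set C) :=
  [set S | exists g i, S = lcoset g (vertex_group i)].

Definition X_vertex : Type := set_type X_vertices.

Lemma X_mk_subproof g i : lcoset g (vertex_group i) \in X_vertices.
Proof. by apply/mem_set; exists g, i. Qed.

(* g <G_i, G_(i+1)> *)
Definition X_mk (g : C) (i : 'Z_n) : X_vertex := SigSub (X_mk_subproof g i).

Lemma X_vertexP (v : X_vertex) : exists g i, v = X_mk g i.
Proof.
by case: v => S SX; have [g [i eS]] := set_mem SX; exists g, i; apply: val_inj.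
Qed.

Definition X_adj (v w : X_vertex) : Prop := exists (g : C) (i : 'Z_n),
  (v = X_mk g (i - 1)%R /\ w = X_mk g i) \/ (w = X_mk g (i - 1)%R /\ v = X_mk g i).

Lemma X_adj_sym v w : X_adj v w -> X_adj w v.
Proof. by move=> [g [i vw]]; exists g, i; case: vw; [right | left]. Qed.

Definition X_boundary (g : C) : set ('Z_n -> X_vertex) := dihedral_class (X_mk g).

Lemma X_boundaryP g : exists c,
  (forall i, X_adj (c i) (c (i + 1)%R)) /\ X_boundary g = dihedral_class c.
Proof.
exists (X_mk g); split=> // i; exists g, (i + 1)%R; left; split=> //.
by rewrite GRing.addrK.
Qed.

(* The polygons of X are indexed by the elements g of C_n G. *)
Definition complexX : ngon_complex n := NgonComplex X_adj_sym X_boundaryP.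

Lemma X_vact_subproof (g : C) (v : X_vertex) : lcoset g (val v) \in X_vertices.
Proof.
by have [h [i ->]] := X_vertexP v; apply/mem_set; exists (g * h), i; rewrite lcosetM.
Qed.

Definition X_vact (g : C) (v : X_vertex) : X_vertex := SigSub (X_vact_subproof g v).

Lemma X_vactE g h i : X_vact g (X_mk h i) = X_mk (g * h) i.
Proof. by apply: val_inj; rewrite /= lcosetM. Qed.

Lemma X_vact1 v : X_vact 1 v = v.
Proof. by apply: val_inj; rewrite /= lcoset1. Qed.

Lemma X_vactM g h v : X_vact (g * h) v = X_vact g (X_vact h v).
Proof. by apply: val_inj; rewrite /= lcosetM. Qed.

Lemma X_vact_adj g v w : X_adj v w -> X_adj (X_vact g v) (X_vact g w).
Proof.
move=> [h [i vw]]; exists (g * h), i.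
by case: vw => -[-> ->]; [left | right]; rewrite !X_vactE.
Qed.

Lemma X_boundary_pact g h :
  X_boundary (g * h) = [set X_vact g \o c | c in X_boundary h].
Proof.
rewrite dihedral_class_map /X_boundary; congr dihedral_class.
by apply/funext => i; rewrite /= X_vactE.
Qed.

Definition X_action : complex_action C complexX :=
  @ComplexAction n C complexX X_vact (fun g h => g * h)
    X_vact1 (@mul1g C) X_vactM (fun g h p => esym (mulgA g h p))
    X_vact_adj X_boundary_pact.

End ComplexX.

Arguments vertex_group {n} G i.

Section ComplexScrX.
Variables (n : nat) (G : 'Z_n -> groupType).
Local Notation C := (cyclic_product G).

Definition scrX_vertex : Type := set_type (@C_medium C).

Definition scrX_adj (H K : scrX_vertex) : Prop :=
  C_maximal (join_subgroup (val H) (val K)).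

Lemma scrX_adj_sym H K : scrX_adj H K -> scrX_adj K H.
Proof. by rewrite /scrX_adj /join_subgroup setUC. Qed.

Definition scrX_cycles : set (set ('Z_n -> scrX_vertex)) :=
  [set D | exists c, induced_cycle scrX_adj c /\ D = dihedral_class c].

Definition scrX_polygon : Type := set_type scrX_cycles.

Lemma scrX_boundaryP (p : scrX_polygon) : exists c,
  (forall i, scrX_adj (c i) (c (i + 1)%R)) /\ val p = dihedral_class c.
Proof.
have [c [[_ cE] ->]] := set_mem (valP p).
by exists c; split=> // i; apply/cE; left.
Qed.

Definition complexScrX : ngon_complex n := NgonComplex scrX_adj_sym scrX_boundaryP.

Lemma scrX_vact_subproof (g : C) (H : scrX_vertex) :
  conj_set g (val H) \in (@C_medium C).
Proof. by apply/mem_set/conj_C_medium/set_mem/valP. Qed.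

Definition scrX_vact (g : C) (H : scrX_vertex) : scrX_vertex :=
  SigSub (scrX_vact_subproof g H).

Lemma scrX_vact1 H : scrX_vact 1 H = H.
Proof. by apply: val_inj; rewrite /= conj_set1. Qed.

Lemma scrX_vactM g h H : scrX_vact (g * h) H = scrX_vact g (scrX_vact h H).
Proof. by apply: val_inj; rewrite /= conj_setM. Qed.

Lemma scrX_vact_adj g H K :
  scrX_adj H K -> scrX_adj (scrX_vact g H) (scrX_vact g K).
Proof. by rewrite /scrX_adj /= -conj_join; apply: conj_C_maximal. Qed.

Lemma scrX_vact_adjE g H K :
  scrX_adj (scrX_vact g H) (scrX_vact g K) <-> scrX_adj H K.
Proof.
split; last exact: scrX_vact_adj.
by move=> /(scrX_vact_adj g^-1); rewrite -!scrX_vactM mulVg !scrX_vact1.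
Qed.

Lemma scrX_pact_subproof (g : C) (p : scrX_polygon) :
  [set scrX_vact g \o c | c in val p] \in scrX_cycles.
Proof.
have [c [[injc cE] ->]] := set_mem (valP p); apply/mem_set.
exists (scrX_vact g \o c); split; last exact: dihedral_class_map.
split=> [i j /(congr1 (scrX_vact g^-1))|i j]; last first.
  by rewrite -cE; apply: scrX_vact_adjE.
by rewrite /= -!scrX_vactM mulVg !scrX_vact1; apply: injc.
Qed.

Definition scrX_pact (g : C) (p : scrX_polygon) : scrX_polygon :=
  SigSub (scrX_pact_subproof g p).

Lemma scrX_pact1 p : scrX_pact 1 p = p.
Proof.
apply: val_inj; rewrite /= -[RHS]image_id; apply: eq_imagel => c _.
by apply/funext => i; rewrite /= scrX_vact1.
Qed.

Lemma scrX_pactM g h p : scrX_pact (g * h) p = scrX_pact g (scrX_pact h p).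
Proof.
apply: val_inj; rewrite /= image_comp; apply: eq_imagel => c _.
by apply/funext => i; rewrite /= scrX_vactM.
Qed.

Definition scrX_action : complex_action C complexScrX :=
  @ComplexAction n C complexScrX scrX_vact scrX_pact
    scrX_vact1 scrX_pact1 scrX_vactM scrX_pactM
    scrX_vact_adj (fun g p => erefl).

End ComplexScrX.

(* Main.v *)
(* C_n G is the graph product of the G_i over the n-cycle. Reading a word as a *)
(* path in the group, a letter in G_v crosses, at the prefix g, the wall given *)
(* by the coset g St(v), where St(v) is generated by G_(v-1), G_v, G_(v+1).    *)
(* The product of the letters crossing a given wall depends only on the group  *)
(* element; it follows that reduced words cross each wall at most once, that   *)
(* they have minimal support, and that an intersection of two conjugates of    *)
(* parabolic subgroups P_S, P_T is conjugate to P_U for some U in S /\ T.      *)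
(* Let A x B be a subgroup split as a product. An element a of A lying in no   *)
(* conjugate of a star subgroup would have a common nontrivial power with any  *)
(* commuting element, which is impossible for an element of B; otherwise the   *)
(* centraliser of a lies in a conjugate of a star subgroup. As n >= 5, two     *)
(* distinct conjugates of star subgroups meet inside a conjugate of an edge    *)
(* subgroup, and it follows that A x B lies in a conjugate of a star subgroup. *)
(* Hence the C-maximal, C-medium and C-minimal subgroups are the conjugates of *)
(* star, edge and vertex subgroups. Adjacency is settled by ping-pong in       *)
(* G_(i-1) * G_(i+1), and an embedded n-cycle in X is a polygon: either its    *)
(* types are monotone, or walls at its turning points are crossed only once.   *)

Require Import Defs.
From mathcomp Require Import all_boot all_order all_algebra.
From mathcomp Require Import mathcomp_extra boolp classical_sets.
From mathcomp Require Import zify.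

Set Implicit Arguments.
Unset Strict Implicit.
Unset Printing Implicit Defensive.

Import Algebra GRing.Theory.
Local Open Scope classical_set_scope.
Local Open Scope group_scope.

(** The group is a graph product over the n-cycle, and for n >= 5 this cycle has neither triangles
    nor squares. Write P_S ([para S]) for the subgroup generated by the G_i with i in S. The basic
    tool is the walls, the cosets g P_S with S the star of some v: by [cross_rel] the product of the
    letters of a word that cross a given wall depends only on the group element. Hence membership in
    P_S is read off any reduced word ([reduced_para]), and P_S meets a conjugate of P_T in a
    conjugate of some P_U ([para_conjI]).

    Vertices: a star subgroup is the direct product of G_v and the subgroup generated by its two
    neighbours, and [splits_sub_star] places every product subgroup in a conjugate of a star
    subgroup; so these conjugates are the maximal products. Two distinct ones meet inside a
    conjugate of an edge subgroup ([star_conjI]), whence the C-medium subgroups are the conjugates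
    of the <G_i, G_(i+1)> ([C_mediumP]). An edge subgroup is its own normaliser and determines its
    type ([conj_edge_eq]), so gH -> gHg^-1 is a bijection on vertices.

    Edges: two conjugates of edge subgroups generate a C-maximal subgroup exactly when the cosets
    are adjacent ([C_maximal_adj]). The hard case is two edges of one star, settled by ping-pong in
    [generate_star].

    Polygons: adjacency changes the type of a vertex by one, so polygons of X give induced cycles.
    Conversely the types along an embedded n-cycle form a closed walk of length n in Z/n, of winding
    number 1, -1 or 0. A winding cycle bounds a polygon ([monotone_polygon]); a cycle of winding
    number 0 would turn back and pass twice through one vertex ([no_reversal]). [cycle_polygon]
    combines the cases. *)

Lemma cat_cons_split (T : Type) (a b p q : seq T) (x : T) :
  a ++ b = p ++ x :: q ->
  (exists2 c, a = p ++ x :: c & q = c ++ b) \/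
  (exists2 c, b = c ++ x :: q & p = a ++ c).
Proof.
elim: a p => [|y a IHa] [|z p] /=.
- by move=> ->; right; exists [::].
- by move=> ->; right; exists (z :: p).
- by move=> [-> <-]; left; exists a.
- by move=> [-> /IHa[[c -> ->]|[c -> ->]]]; [left; exists c|right; exists c].
Qed.

(** * Words and walls *)

Section Words.
Variables (n : nat) (G : 'Z_n -> groupType).
Local Notation C := (cyclic_product G).
Local Notation word := (seq (letter G)).
Implicit Types (i j v : 'Z_n) (S T : pred 'Z_n) (l m : letter G) (u w : word).
Implicit Types (g h k : C) (Q : set C).

Definition adjz i j := (j == i + 1)%R || (i == j + 1)%R.
Definition star i j := (i == j) || adjz i j.

Lemma adjzC i j : adjz i j = adjz j i. Proof. by rewrite /adjz orbC. Qed.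
Lemma starC i j : star i j = star j i. Proof. by rewrite /star adjzC eq_sym. Qed.
Lemma star_refl i : star i i. Proof. by rewrite /star eqxx. Qed.

Lemma cyc_class_cat u w : cyc_class (u ++ w) = cyc_class u * cyc_class w.
Proof. by apply/cyc_classP; apply: cyc_cat; apply/cyc_sym/cyc_classK. Qed.

Lemma cyc_class_nil : cyc_class [::] = 1 :> C. Proof. by []. Qed.

Lemma cyc_class_cons l u : cyc_class (l :: u) = cyc_class [:: l] * cyc_class u.
Proof. by rewrite -cyc_class_cat. Qed.

Lemma cyc_in1 i : cyc_in (1 : G i) = 1.
Proof. by apply/cyc_classP/cyc_one. Qed.

Lemma cyc_inM i : {morph @cyc_in n G i : x y / x * y}.
Proof. by move=> x y; rewrite /cyc_in -cyc_class_cat; apply/cyc_classP/cyc_sym/cyc_mul. Qed.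

Lemma cyc_inV i (x : G i) : cyc_in x^-1 = (cyc_in x)^-1.
Proof. by apply/esym/mulg1_eq; rewrite -cyc_inM mulgV cyc_in1. Qed.

Lemma cyc_in_letter l : cyc_class [:: l] = cyc_in (tagged l).
Proof. by case: l. Qed.

Lemma cyc_class_inv u : cyc_class (inv_word u) = (cyc_class u)^-1.
Proof.
apply/esym/mulg1_eq; rewrite -cyc_class_cat -cyc_class_nil.
exact/cyc_classP/cyc_rel_mulV.
Qed.

Lemma cyc_in_commute i j (x : G i) (y : G j) :
  adjz i j -> cyc_in x * cyc_in y = cyc_in y * cyc_in x.
Proof.
by case/orP=> /eqP e; subst; rewrite /cyc_in -!cyc_class_cat; apply/cyc_classP;
  [|apply: cyc_sym]; apply: cyc_comm.
Qed.

Definition letters_in S u := all (fun l => S (tag l)) u.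

Definition para S : set C := [set g | exists2 u, letters_in S u & cyc_class u = g].

Lemma letters_in_cat S u w : letters_in S (u ++ w) = letters_in S u && letters_in S w.
Proof. exact: all_cat. Qed.

Lemma letters_in_inv S u : letters_in S (inv_word u) = letters_in S u.
Proof. by rewrite /letters_in /inv_word all_rev all_map; apply: eq_all => -[]. Qed.

Lemma sub_letters_in S T u : (forall i, S i -> T i) -> letters_in S u -> letters_in T u.
Proof. by move=> sST; apply: sub_all => l; apply: sST. Qed.

Lemma para_word S u : letters_in S u -> para S (cyc_class u).
Proof. by exists u. Qed.

Lemma para1 S : para S 1. Proof. by exists [::]. Qed.

Lemma paraM S g h : para S g -> para S h -> para S (g * h).
Proof.
by move=> [u Su <-] [w Sw <-]; exists (u ++ w); rewrite ?letters_in_cat ?Su // cyc_class_cat.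
Qed.

Lemma paraV S g : para S g -> para S g^-1.
Proof. by move=> [u Su <-]; exists (inv_word u); rewrite ?letters_in_inv ?cyc_class_inv. Qed.

Lemma paraMl S g h : para S g -> para S (g * h) <-> para S h.
Proof. by move=> Sg; split=> [/(paraM (paraV Sg))|/(paraM Sg)//]; rewrite mulKg. Qed.

Lemma paraMr S g h : para S h -> para S (g * h) <-> para S g.
Proof.
by move=> Sh; split=> [/paraM/(_ (paraV Sh))|/paraM/(_ Sh)//]; rewrite mulgK.
Qed.

Lemma paraVE S g : para S g^-1 <-> para S g.
Proof. by split=> /paraV //; rewrite invgK. Qed.

Lemma para_in S i (x : G i) : S i -> para S (cyc_in x).
Proof. by move=> Si; exists [:: mk_letter x]; rewrite /letters_in ?/= ?Si. Qed.

Lemma sub_para S T : (forall i, S i -> T i) -> para S `<=` para T.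
Proof. by move=> sST _ [u Su <-]; apply/para_word/(sub_letters_in sST). Qed.

Lemma eq_para S T : S =1 T -> para S = para T.
Proof. by move=> eST; apply/seteqP; split; apply: sub_para => i; rewrite eST. Qed.

Lemma para_subgroup S : is_subgroup (para S).
Proof. by split=> [|g h Sg Sh]; [exact: para1 | exact/paraM/paraV]. Qed.

Lemma para0 S g : (forall i, ~~ S i) -> para S g -> g = 1.
Proof. by move=> S0 [[|l u] /= + <-] //; rewrite (negbTE (S0 _)). Qed.

Lemma para_min S (H : set C) : is_subgroup H ->
  (forall i (x : G i), S i -> H (cyc_in x)) -> para S `<=` H.
Proof.
move=> [H1 HF] HS _ [u + <-].
have HV x : H x -> H x^-1 by move=> Hx; rewrite -div1g; apply: HF.
have HM x y : H x -> H y -> H (x * y).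
  by move=> Hx Hy; rewrite -(invgK y); apply/HF/HV.
elim: u => [//|l u IHu] /= /andP[Sl /IHu Hu].
by rewrite cyc_class_cons cyc_in_letter; apply: HM => //; apply: HS.
Qed.

Lemma para1P i g : para (pred1 i) g <-> exists x : G i, g = cyc_in x.
Proof.
split=> [|[x ->]]; last by apply: para_in; rewrite /= eqxx.
have sg : is_subgroup (range (@cyc_in n G i)).
  split=> [|_ _ [x _ <-] [y _ <-]]; first by exists 1; rewrite ?cyc_in1.
  by exists (x / y) => //; rewrite cyc_inM cyc_inV.
move=> /(para_min sg)[|x _ <-]; last by exists x.
by move=> j x /= /eqP e; subst; exists x.
Qed.

Lemma para_commute S T g h : (forall i j, S i -> T j -> adjz i j) ->
  para S g -> para T h -> g * h = h * g.
Proof.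
move=> adjST Sg.
have sgC x : is_subgroup [set y | commute x y].
  split=> [|y z xy xz]; first exact: commute1.
  by apply: commuteM => //; apply: commuteV.
suff: para T `<=` [set y | commute g y] by apply.
apply: para_min => // j y Tj /=; apply: commute_sym.
suff: para S `<=` [set x | commute (cyc_in y) x] by apply.
apply: para_min => // i x Si; apply: cyc_in_commute.
by rewrite adjzC; apply: adjST.
Qed.

Definition letter_at v l : G v :=
  if tag l =P v is ReflectT e then eq_rect (tag l) G (tagged l) v e else 1.

Lemma letter_atE v (x : G v) : letter_at v (mk_letter x) = x.
Proof. by rewrite /letter_at; case: eqP => // e; rewrite (eq_irrelevance e erefl). Qed.

Lemma letter_at_neq v l : tag l != v -> letter_at v l = 1.
Proof. by rewrite /letter_at; case: eqP. Qed.

(* The product of the letters in G_v of u that are read, starting from g, at *)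
(* a prefix in Q: for Q = setT this is the retraction onto G_v, and for Q a  *)
(* coset of the subgroup of the star of v this is how the path u from g      *)
(* crosses the wall Q.                                                       *)
Fixpoint cross v Q g u : G v :=
  if u is l :: u' then
    (if `[< Q g >] then letter_at v l else 1) * cross v Q (g * cyc_class [:: l]) u'
  else 1.

Definition star_stable v Q :=
  forall g j (x : G j), star v j -> Q (g * cyc_in x) <-> Q g.

Lemma cross_cat v Q g u w :
  cross v Q g (u ++ w) = cross v Q g u * cross v Q (g * cyc_class u) w.
Proof.
elim: u g => [|l u IHu] g /=; first by rewrite mul1g cyc_class_nil mulg1.
by rewrite IHu (cyc_class_cons l u) !mulgA.
Qed.

(** Only the defining relations need checking. A letter that is exchanged with, or multiplied by, a
    letter of G_v has its tag in the star of v, so reading it does not change whether the prefix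
    lies in [Q]. *)
Lemma cross_rel v Q g u w : star_stable v Q -> cyc_rel u w ->
  cross v Q g u = cross v Q g w.
Proof.
move=> sQ uw; elim: uw g => {u w} //.
- by move=> u1 u2 u3 _ IH1 _ IH2 g; rewrite IH1.
- move=> u u' w w' uu' IHu ww' IHw g.
  by rewrite !cross_cat IHu IHw ((cyc_classP u u').2 uu').
- move=> i g /=; rewrite mulg1; case: asboolP => // _.
  by have [e|ne] := eqVneq i v; [subst; rewrite letter_atE | rewrite letter_at_neq].
- move=> i x y g /=; rewrite !mulg1.
  have [e|neq] := eqVneq i v; last by rewrite !letter_at_neq // !if_same mulg1.
  subst; rewrite !letter_atE (asbool_equiv_eq (sQ g v x (star_refl v))).
  by case: ifP; rewrite ?mulg1.
- move=> i x y g /=; rewrite !mulg1.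
  have ne : (i + 1)%R != i by rewrite -subr_eq0 addrAC subrr add0r oner_eq0.
  have [e|neq] := eqVneq i v; last first.
    rewrite !(@letter_at_neq v (mk_letter x)) // !if_same mulg1 mul1g.
    have [e|neq'] := eqVneq (i + 1)%R v; last by rewrite !letter_at_neq ?if_same.
    rewrite (asbool_equiv_eq (sQ g i x _)) //.
    by rewrite -e /star /adjz eqxx !orbT.
  subst; rewrite (asbool_equiv_eq (sQ g _ y _)); last first.
    by rewrite /star /adjz eqxx !orbT.
  by rewrite (@letter_at_neq v (mk_letter y)) // !if_same mul1g mulg1.
Qed.

Lemma cross_class v Q g u w : star_stable v Q -> cyc_class u = cyc_class w ->
  cross v Q g u = cross v Q g w.
Proof. by move=> sQ /cyc_classP; apply: cross_rel. Qed.

Lemma cross_free v Q g u :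
  (forall u1 l u2, u = u1 ++ l :: u2 -> tag l = v -> ~ Q (g * cyc_class u1)) ->
  cross v Q g u = 1.
Proof.
elim: u g => [//|l u IHu] g nQ /=.
have -> : (if `[< Q g >] then letter_at v l else 1) = 1.
  have [e|/letter_at_neq->] := eqVneq (tag l) v; last by rewrite if_same.
  by case: asboolP => // Qg; case: (nQ [::] l u) => //; rewrite cyc_class_nil mulg1.
rewrite mul1g; apply: IHu => u1 m u2 def_u /(nQ (l :: u1) m u2).
by rewrite def_u (cyc_class_cons l u1) mulgA; apply.
Qed.

Lemma cross_neq1 v Q g u : cross v Q g u <> 1 ->
  exists u1 l u2, [/\ u = u1 ++ l :: u2, tag l = v & Q (g * cyc_class u1)].
Proof.
apply: contra_notP => nQ; apply: cross_free => u1 l u2 def_u tl Qg.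
by apply: nQ; exists u1, l, u2.
Qed.

Lemma letter_at_tag l : letter_at (tag l) l = tagged l.
Proof. by case: l => i x; apply: (letter_atE x). Qed.

Definition wall v k : set C := [set g | para (star v) (k^-1 * g)].

Lemma wall_stable v k : star_stable v (wall v k).
Proof. by move=> g j x vj; rewrite /wall /= mulgA; apply/paraMr/para_in. Qed.

Lemma wall_id v k : wall v k k. Proof. by rewrite /wall /= mulVg; apply: para1. Qed.

(** Reduced words of a graph product: no trivial letter, and no two letters of one factor that
    commutations could bring together. *)
Definition reduced u :=
  (forall u1 l u2, u = u1 ++ l :: u2 -> tagged l <> 1) /\
  (forall u1 l u2 m u3, u = u1 ++ l :: u2 ++ m :: u3 -> tag l = tag m ->
     ~~ letters_in (star (tag l)) u2).

Lemma reduced_infix u1 u u2 : reduced (u1 ++ u ++ u2) -> reduced u.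
Proof.
move=> [nt red]; split=> [w1 l w2 def_u|w1 l w2 m w3 def_u].
  by apply: (nt (u1 ++ w1) l (w2 ++ u2)); rewrite def_u -!catA.
by apply: (red (u1 ++ w1) l w2 m (w3 ++ u2)); rewrite def_u -!catA /= -!catA.
Qed.

Lemma reduced_catl u w : reduced (u ++ w) -> reduced u.
Proof. exact: (@reduced_infix [::]). Qed.

Lemma reduced_catr u w : reduced (u ++ w) -> reduced w.
Proof. by rewrite -{1}(cats0 w); apply: reduced_infix. Qed.

(** A second crossing of the wall of [l] would put the subword between the two letters in the star
    subgroup of v. The second hypothesis, an instance of [reduced_para] for shorter words, then
    makes it a word in star letters, against reducedness. *)
Lemma cross_reduced_rec u1 l u2 (v := tag l) (u := u1 ++ l :: u2) :
  reduced u ->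
  (forall w1 w w2, u = w1 ++ w ++ w2 -> size w < size u ->
     para (star v) (cyc_class w) -> letters_in (star v) w) ->
  cross v (wall v (cyc_class u1)) 1 u = tagged l.
Proof.
move=> red IH; rewrite cross_cat /= (asboolT _); last first.
  by rewrite mul1g; apply: wall_id.
rewrite letter_at_tag !cross_free ?mul1g ?mulg1 //.
- move=> w1 m w2 def_u2 tm; rewrite /wall /= -?mulgA.
 rewrite mulKg.  rewrite cyc_in_letter paraMl; last by apply: para_in; apply: star_refl.
  move=> w1Q; have def_u : u = u1 ++ l :: w1 ++ m :: w2 by rewrite /u def_u2.
  have := red.2 _ _ _ _ _ def_u; rewrite tm (IH (rcons u1 l) w1 (m :: w2)) ?cat_rcons //.
    by move=> /(_ erefl).
  by rewrite def_u !size_cat /= size_cat; lia.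
- move=> w1 m w2 def_u1 tm; rewrite /wall /= mul1g => w1Q.
  have def_u : u = w1 ++ m :: w2 ++ l :: u2 by rewrite /u def_u1 -catA.
  have := red.2 _ _ _ _ _ def_u; rewrite tm (IH (rcons w1 m) w2 (l :: u2)) ?cat_rcons //.
  - by move=> /(_ erefl).
  - by rewrite def_u !size_cat /= size_cat; lia.
  move: w1Q; rewrite def_u1 cyc_class_cat cyc_class_cons invgM mulgVK -paraVE invgK.
  by rewrite cyc_in_letter paraMl //; apply: para_in; rewrite tm star_refl.
Qed.

Lemma letters_in_split S u :
  (forall u1 l u2, u = u1 ++ l :: u2 -> S (tag l)) -> letters_in S u.
Proof.
elim: u => [//|l u IHu] Su /=; rewrite (Su [::] l u) //=.
by apply: IHu => u1 m u2 def_u; apply: (Su (l :: u1) m u2); rewrite def_u.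
Qed.

(* A reduced word crosses the wall at each of its letters only once, so that  *)
(* every other word for the same element has to cross this wall too.         *)
Lemma reduced_para S u : reduced u -> para S (cyc_class u) -> letters_in S u.
Proof.
have [N] := ubnP (size u); elim: N S u => // N IHN S u ltuN red [u' Su' def_u'].
suff nt u1 l u2 : u = u1 ++ l :: u2 -> S (tag l).
  exact: letters_in_split.
move=> def_u; set v := tag l.
have : cross v (wall v (cyc_class u1)) 1 u' <> 1.
  rewrite (cross_class _ (@wall_stable v _) def_u') def_u cross_reduced_rec -?def_u //.
    exact: red.1 def_u.
  move=> w1 w w2 def_w ltw; apply: IHN; first exact: leq_trans ltw _.
  by move: red; rewrite def_w; apply: reduced_infix.
move=> /cross_neq1[w1 [m [w2 [def_w tm _]]]].
by move: Su'; rewrite def_w letters_in_cat /= tm => /and3P[].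
Qed.

Lemma cross_reduced u1 l u2 : reduced (u1 ++ l :: u2) ->
  cross (tag l) (wall (tag l) (cyc_class u1)) 1 (u1 ++ l :: u2) = tagged l.
Proof.
move=> red; apply: cross_reduced_rec => // w1 w w2 def_u _; apply: reduced_para.
by move: red; rewrite def_u; apply: reduced_infix.
Qed.

Lemma star_merge v u (u' := [seq l <- u | tag l != v]) : letters_in (star v) u ->
  letters_in (adjz v) u' /\ exists x : G v, cyc_class u = cyc_in x * cyc_class u'.
Proof.
rewrite {}/u'; elim: u => [_|l u IHu /= /andP[vl /IHu[vu [x def_u]]]].
  by split=> //; exists 1; rewrite cyc_in1 mul1g.
rewrite cyc_class_cons def_u cyc_in_letter; case: eqP => [|/eqP] e /=.
  split=> //; case: l e vl => i y /= e; subst => _.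
  by exists (y * x); rewrite cyc_inM mulgA.
have vl' : adjz v (tag l) by case/orP: vl => // /eqP e'; rewrite e' eqxx in e.
split; first by rewrite vl'.
exists x; rewrite (cyc_class_cons l) cyc_in_letter !mulgA; congr (_ * _).
by apply/esym/cyc_in_commute.
Qed.

(** This shortening is what contradicts minimal length in [min_reduced], [double_coset] and
    [reduced_powers]. *)
Lemma star_mergeW v u1 l u2 (u := u1 ++ l :: u2) :
  letters_in (star v) u -> tag l = v -> exists x : G v, exists2 u',
    (size u' < size u)%N &
    [/\ letters_in (adjz v) u', cyc_class u = cyc_in x * cyc_class u'
      & cyc_class u = cyc_class u' * cyc_in x].
Proof.
move=> vu tl; have [vu' [x def_u]] := star_merge vu; exists x.
exists [seq m <- u | tag m != v].
  rewrite /u filter_cat /= tl eqxx /= !size_cat /= !size_filter.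
  by rewrite addnS ltnS leq_add ?count_size.
split=> //; rewrite def_u; apply: (@para_commute (pred1 v) (adjz v)).
- by move=> i j /eqP->.
- by apply: para_in; apply: eqxx.
exact: para_word.
Qed.

Lemma min_word (A : word -> Prop) : (exists u, A u) ->
  exists2 u, A u & forall w, A w -> (size u <= size w)%N.
Proof.
move=> [u Au]; have ex : exists k : nat, `[< exists2 u, A u & size u = k >].
  by exists (size u); apply/asboolP; exists u.
case: (ex_minnP ex) => k /asboolP[w Aw <-] min_k; exists w => // x Ax.
by apply: min_k; apply/asboolP; exists x.
Qed.

Lemma min_reduced u :
  (forall w, cyc_class w = cyc_class u -> (size u <= size w)%N) -> reduced u.
Proof.
move=> min_u; split=> [u1 l u2 def_u l1|u1 l u2 m u3 def_u tlm].
  suff /min_u : cyc_class (u1 ++ u2) = cyc_class u by rewrite def_u !size_cat /=; lia.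
  by rewrite def_u !cyc_class_cat (cyc_class_cons l) cyc_in_letter l1 cyc_in1 mul1g.
apply/negP => ov; have [||x [u' ltu' [_ def_um _]]] := @star_mergeW (tag l) u2 m [::].
- by rewrite letters_in_cat ov /= -tlm star_refl.
- by [].
suff /min_u : cyc_class (u1 ++ mk_letter (tagged l * x) :: u' ++ u3) = cyc_class u.
  move: ltu'; rewrite def_u !size_cat /= !size_cat /=; lia.
rewrite def_u cyc_class_cat (cyc_class_cons _ (u' ++ u3)) cyc_in_letter cyc_class_cat.
rewrite cyc_inM -cat1s -[m :: u3]cat1s !cyc_class_cat (cyc_in_letter l).
by move: def_um; rewrite cyc_class_cat => def_um; rewrite -mulgA (mulgA _ _ (cyc_class u3)) -def_um !mulgA.
Qed.

Lemma reduced_word g : exists2 u, reduced u & cyc_class u = g.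
Proof.
have [|u <- min_u] := @min_word (fun u => cyc_class u = g).
  by exists (cyc_word g); apply: cyc_wordK.
by exists u => //; apply: min_reduced.
Qed.

Lemma paraI S T g : para S g -> para T g -> para (predI S T) g.
Proof.
have [u red <-] := reduced_word g => /(reduced_para red) Su /(reduced_para red) Tu.
by apply: para_word; move: Su Tu; rewrite /letters_in; elim: u {red} => //= l u IHu
  /andP[-> Su] /andP[-> Tu]; rewrite IHu.
Qed.

Lemma reduced_letter i (x : G i) : x <> 1 -> reduced [:: mk_letter x].
Proof.
move=> ntx; split=> [[|l' []] //= l u2 e|[|l' []] // l [] //].
by have /= <- := congr1 (head l) e.
Qed.

Lemma para_inE S i (x : G i) : x <> 1 -> para S (cyc_in x) -> S i.
Proof. by move=> /reduced_letter red /(reduced_para red) /andP[]. Qed.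

Lemma cyc_in_inj i : injective (@cyc_in n G i).
Proof.
move=> x y exy; apply/divg1_eq; apply: contrapT => nt.
suff : para pred0 (cyc_in (x / y)) by move=> /(para_inE nt).
by rewrite cyc_inM cyc_inV exy mulgV; apply: para1.
Qed.

(** No letter of S can be moved to the left (for [rmin], right) end of the word, where P_S would
    absorb it; shortest representatives of double cosets have this property. *)
Definition lmin S u := forall u1 l u2,
  u = u1 ++ l :: u2 -> S (tag l) -> ~~ letters_in (star (tag l)) u1.
Definition rmin S u := forall u1 l u2,
  u = u1 ++ l :: u2 -> S (tag l) -> ~~ letters_in (star (tag l)) u2.

Lemma double_coset S T g : exists s w t,
  [/\ para S s, para T t, g = s * cyc_class w * t & [/\ reduced w, lmin S w & rmin T w]].
Proof.
have [|w [s [t [Ss Tt def_g]]] min_w] := @min_word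
  (fun w => exists s t, [/\ para S s, para T t & g = s * cyc_class w * t]).
  have [u _ <-] := reduced_word g; exists u, 1, 1.
  by rewrite mul1g mulg1; split=> //; apply: para1.
exists s, w, t; split=> //; split.
- by apply: min_reduced => u def_u; apply: min_w; exists s, t; rewrite def_u.
- move=> u1 l u2 def_w Sl; apply/negP => ov.
  have [|//|x [u' ltu' [_ def_u _]]] := @star_mergeW (tag l) u1 l [::].
    by rewrite letters_in_cat ov /= star_refl.
  suff /min_w : exists s t, [/\ para S s, para T t & g = s * cyc_class (u' ++ u2) * t].
    by rewrite def_w; move: ltu'; rewrite !size_cat /=; lia.
  exists (s * cyc_in x), t; split=> //; first by apply/paraM/para_in.
  rewrite def_g def_w -[l :: u2]cat1s catA !cyc_class_cat -cyc_class_cat def_u.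
  by rewrite !mulgA.
- move=> u1 l u2 def_w Tl; apply/negP => ov.
  have [|//|x [u' ltu' [_ _ def_u]]] := @star_mergeW (tag l) [::] l u2.
    by rewrite /= star_refl.
  suff /min_w : exists s t, [/\ para S s, para T t & g = s * cyc_class (u1 ++ u') * t].
    by rewrite def_w; move: ltu'; rewrite !size_cat /=; lia.
  exists s, (cyc_in x * t); split=> //; first by apply/paraM=> //; apply: para_in.
  by rewrite def_g def_w !cyc_class_cat [X in _ * (_ * X)]def_u !mulgA.
Qed.

Lemma reduced_lmin S r w : reduced r -> letters_in S r -> reduced w -> lmin S w ->
  reduced (r ++ w).
Proof.
move=> redr Sr redw lw; split=> [u1 l u2|u1 l u2 m u3].
  by move=> e; case: (cat_cons_split e) => [[c def_r _]|[c def_w _]]; [exact: redr.1 _ _ _ def_r|exact: redw.1 _ _ _ def_w].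
move=> e; case: (cat_cons_split e) => [[c def_r def_c]|[c def_w _] tlm]; last exact: redw.2 _ _ _ _ _ def_w tlm.
case: (cat_cons_split (esym def_c)) => [[d def_d _]|[d def_w ->]] tlm.
  by apply: (redr.2 u1 l u2 m d) => //; rewrite def_r def_d.
rewrite letters_in_cat negb_and tlm (lw d m u3) ?orbT //.
by rewrite -tlm; move: Sr; rewrite def_r letters_in_cat => /and3P[].
Qed.

Lemma reduced_rmin S r w : reduced r -> letters_in S r -> reduced w -> rmin S w ->
  reduced (w ++ r).
Proof.
move=> redr Sr redw rw; split=> [u1 l u2|u1 l u2 m u3].
  by move=> e; case: (cat_cons_split e) => [[c def_w _]|[c def_r _]]; [apply: redw.1 _ _ _ def_w|apply: redr.1 _ _ _ def_r].
move=> e; case: (cat_cons_split e) => [[c def_w def_c]|[c def_r _] tlm]; last exact: redr.2 _ _ _ _ _ def_r tlm.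
case: (cat_cons_split (esym def_c)) => [[d def_d _]|[d def_r ->]] tlm.
  by apply: (redw.2 u1 l u2 m d) => //; rewrite def_w def_d.
rewrite letters_in_cat negb_and (rw u1 l c) //.
by rewrite tlm; move: Sr; rewrite def_r letters_in_cat => /and3P[].
Qed.

Definition link u i := letters_in (adjz i) u.

(** The wall of the first letter [l] of [w] is crossed by [w * t], hence by [r ++ l :: w] for a
    reduced word [r] of [h]. The crossing is not in [r], as v is not in S, nor after [l], as [w] is
    reduced; so it is at [l], which forces [r] into the neighbours of v. Thus [h] commutes with [l],
    and induction strips [l] off. *)
Lemma commute_min S T h t w : reduced w -> lmin S w -> rmin T w ->
  para S h -> para T t -> h * cyc_class w = cyc_class w * t ->
  para [pred i | [&& S i, T i & link w i]] h.
Proof.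
elim: w S h => [|l w IHw] S h red lw rw Sh Tt.
  rewrite cyc_class_nil mulg1 mul1g => e; rewrite -e in Tt.
  by apply: sub_para (paraI Sh Tt) => i /= /andP[-> ->].
move=> ehw; set v := tag l.
have [r redr def_r] := reduced_word h; have [r' redr' def_r'] := reduced_word t.
have Sr : letters_in S r by apply: reduced_para redr _; rewrite def_r.
have Tr' : letters_in T r' by apply: reduced_para redr' _; rewrite def_r'.
have nSv : ~~ S v by apply/negP => Sv; have := lw [::] l w erefl Sv.
have /cross_neq1[p [m [q [def_p tm]]]] :
    cross v (wall v (cyc_class [::])) 1 (r ++ l :: w) <> 1.
  rewrite (@cross_class _ _ _ _ (l :: w ++ r')); last 2 first.
  - exact: wall_stable.
  - by rewrite -cat_cons !cyc_class_cat def_r def_r'.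
  rewrite (@cross_reduced [::]); first exact: (red.1 [::]).
  exact: reduced_rmin redr' Tr' red rw.
rewrite /wall /= cyc_class_nil invg1 !mul1g.
have redrw : reduced (r ++ l :: w) by exact: reduced_lmin redr Sr red lw.
have redp : reduced p by move: redrw; rewrite def_p; apply: reduced_catl.
move=> /(reduced_para redp) vp.
case: (cat_cons_split def_p) => [[c def_c _]|[c def_c ep]].
  by move: Sr; rewrite def_c letters_in_cat /= tm (negbTE nSv) andbF.
case: c def_c ep => [_|l' c [<-] def_w] ep; last first.
  move: vp; rewrite ep letters_in_cat => /and3P[_ _ vc].
  by have /negP[] := red.2 [::] l c m q (congr1 (cons l) def_w) (esym tm).
rewrite {}ep cats0 in vp.
have vh : para (predI S (adjz v)) h.
  rewrite -def_r; apply: para_word; move: Sr vp nSv; rewrite /letters_in.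
  elim: (r) => //= l' r1 IHr /andP[Sl Sr] /andP[vl vr] nSv.
  rewrite Sl IHr // andbT; case/orP: vl => // /eqP e.
  by rewrite e Sl in nSv.
have hl : h * cyc_class [:: l] = cyc_class [:: l] * h.
  rewrite cyc_in_letter; apply: (@para_commute (predI S (adjz v)) (pred1 v)) => //.
    by move=> i j /andP[_ +] /eqP->; rewrite adjzC.
  by apply: para_in; apply: eqxx.
(* S shrinks to its indices adjacent to v: letters of those factors also move past [l], so left
   minimality passes to the tail. *)
have := IHw (predI S (adjz v)) h (reduced_catr (u := [:: l]) red).
case=> //.
- move=> u1 m' u2 def_w /andP[Sm vm].
  by have := lw (l :: u1) m' u2; rewrite def_w => /(_ erefl Sm) /=; rewrite /star -/v adjzC vm orbT.
- by move=> u1 m' u2 def_w Tm; apply: (rw (l :: u1) m' u2); rewrite // def_w.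
- by move: ehw; rewrite (cyc_class_cons l w) mulgA hl -!mulgA => /mulgI.
move=> u Su <-; apply: para_word; apply: sub_letters_in Su => i /=.
by rewrite /link /= -/v adjzC => /and3P[/andP[-> ->] -> ->].
Qed.

Lemma link_commute w h : para (link w) h -> h * cyc_class w = cyc_class w * h.
Proof.
move=> wh; apply: (@para_commute (link w) [pred j | [forall i, link w i ==> adjz i j]]) => //.
  by move=> i j wi /forallP/(_ i); rewrite wi.
apply/para_word/letters_in_split => u1 l u2 def_w /=; apply/forallP => i; apply/implyP.
by rewrite /link def_w letters_in_cat => /and3P[].
Qed.

Lemma conj_setE g (A : set C) y : conj_set g A y <-> A (g^-1 * y * g).
Proof.
split=> [[x Ax <-]|Ay]; first by rewrite !mulgA mulVg mul1g mulgVK.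
by exists (g^-1 * y * g); rewrite // !mulgA mulgV mul1g mulgK.
Qed.

Lemma conj_para S g : para S g -> conj_set g (para S) = para S.
Proof.
move=> Sg; apply/seteqP; split=> y; rewrite conj_setE paraMr // paraMl //; exact: paraV.
Qed.

(* w is a shortest word representing an element of the double coset of g. *)
Lemma para_conjI S T g : exists s w t,
  [/\ para S s, para T t, g = s * cyc_class w * t, lmin S w
    & para S `&` conj_set g (para T) =
      conj_set s (para [pred i | [&& S i, T i & link w i]])].
Proof.
have [s [w [t [Ss Tt def_g [redw lw rw]]]]] := double_coset S T g.
exists s, w, t; split=> //; apply/seteqP; split=> h; rewrite /= !conj_setE.
  move=> [Sh]; have Sh' : para S (s^-1 * h * s).
    by apply: paraM => //; apply: paraM => //; apply: paraV.
  rewrite def_g !invgM => Th.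
  apply: (@commute_min _ _ _ ((cyc_class w)^-1 * (s^-1 * h * s) * cyc_class w)) => //.
    by move: Th; rewrite !mulgA paraMr // -!mulgA paraMl //; apply: paraV.
  by rewrite !mulgA mulgV mul1g.
move=> Sh; split.
  have : para S (s^-1 * h * s) by apply: sub_para Sh => i /andP[].
  by rewrite paraMr // paraMl //; apply: paraV.
have ch : s^-1 * h * s * cyc_class w = cyc_class w * (s^-1 * h * s).
  by apply: link_commute; apply: sub_para Sh => i /and3P[].
have -> : g^-1 * h * g = t^-1 * (s^-1 * h * s) * t.
  by rewrite -(mulKg (cyc_class w) (s^-1 * h * s)) -ch def_g !invgM !mulgA.
apply: paraM => //; apply: paraM; first exact: paraV.
by apply: sub_para Sh => i /and3P[].
Qed.

End Words.

Arguments para {n G} S.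

(** * Indices modulo n: no triangles and no squares *)

Section CyclicIndices.
Variable n : nat.
Hypothesis hn : (5 <= n)%N.
Implicit Types i j k u v w x y z : 'Z_n.

Lemma ltZn i : (i < n)%N.
Proof. by apply: leq_trans (ltn_ord i) _; rewrite Zp_cast // (leq_trans _ hn). Qed.

Lemma val_Zn_succ i : (i + 1)%R = (if i.+1 == n then 0 else i.+1) :> nat.
Proof.
have n1 : (1 < n)%N by rewrite (leq_trans _ hn).
have -> : ((i + 1)%R = (i + 1) %% n :> nat)%N by rewrite /= modnDmr; congr (_ %% _)%N; apply: Zp_cast.
have := ltZn i; rewrite leq_eqVlt addn1.
by case: eqP => [->|_ /modn_small//]; rewrite modnn.
Qed.

Lemma succ_ZnP i j : (i = j + 1)%R <->
  (i = j.+1 :> nat \/ (i = 0 :> nat) /\ (j.+1 = n :> nat)).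
Proof.
transitivity (i = (j + 1)%R :> nat); first by split=> [->|/val_inj].
rewrite val_Zn_succ; have := ltZn i; case: eqP; lia.
Qed.

Lemma adjzP i j : adjz i j <->
  (j = i.+1 :> nat \/ j = 0 :> nat /\ i.+1 = n :> nat) \/
  (i = j.+1 :> nat \/ i = 0 :> nat /\ j.+1 = n :> nat).
Proof.
rewrite -!succ_ZnP /adjz; split=> [/orP[]/eqP|[]->]; auto.
  by rewrite eqxx.
by rewrite eqxx orbT.
Qed.

Lemma eqZnP i j : i = j <-> i = j :> nat.
Proof. by split=> [->|/val_inj]. Qed.

Lemma starP i j : star i j <-> i = j \/ adjz i j.
Proof. by rewrite /star; split=> [/orP[/eqP|]|[->|->]]; rewrite ?eqxx ?orbT; auto. Qed.

Lemma adjz_irr i : adjz i i = false.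
Proof. apply/negP => /adjzP; have := ltZn i; lia. Qed.

Lemma adjz_triangle x y z : adjz x y -> adjz y z -> adjz x z = false.
Proof.
move=> /adjzP xy /adjzP yz; apply/negP => /adjzP.
have := ltZn x; have := ltZn y; have := ltZn z; lia.
Qed.

(** Otherwise u, x, w, y would span a square of the n-cycle, which n >= 5 excludes. *)
Lemma starI u w x y : u <> w -> star u x -> star w x -> star u y -> star w y ->
  x = y \/ adjz x y.
Proof.
rewrite !starP !adjzP !eqZnP.
have := ltZn u; have := ltZn w; have := ltZn x; have := ltZn y; lia.
Qed.

Lemma star_adjzI u w x y : ~~ star u w -> star u x -> adjz w x -> star u y -> adjz w y ->
  x = y.
Proof.
move=> /negP; rewrite !starP !adjzP !eqZnP.
have := ltZn u; have := ltZn w; have := ltZn x; have := ltZn y; lia.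
Qed.

Lemma succ_neq i : (i + 1)%R != i.
Proof. by rewrite -subr_eq0 addrAC subrr add0r oner_eq0. Qed.

Lemma succ2_neq i : (i + 1 + 1)%R != i.
Proof.
apply/eqP => /eqZnP; have := (succ_ZnP (i + 1)%R i).1 erefl.
have := (succ_ZnP (i + 1 + 1)%R (i + 1)%R).1 erefl.
have := ltZn i; lia.
Qed.
End CyclicIndices.

(** * Intersections of parabolic subgroups *)

Section Parabolics.
Variables (n : nat) (hn : (5 <= n)%N) (G : 'Z_n -> groupType).
Local Notation C := (cyclic_product G).
Local Notation word := (seq (letter G)).
Implicit Types (i j u v : 'Z_n) (S T : pred 'Z_n) (l m : letter G) (w : word).
Implicit Types (g h k : C) (Q : set C).

Definition edge i : pred 'Z_n := [pred j | (j == i) || (j == i + 1)%R].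

Lemma edge_star i j : edge i j -> star i j.
Proof. by rewrite /star /adjz eq_sym => /orP[]->; rewrite ?orbT. Qed.

Lemma edge_starS i j : edge i j -> star (i + 1)%R j.
Proof.
move=> /orP[]/eqP->; last exact: star_refl.
by rewrite /star /adjz eqxx !orbT.
Qed.

Lemma edgeP i j : edge i j <-> j = i \/ j = (i + 1)%R.
Proof. by split=> [/orP[]/eqP|[]->]; rewrite /edge /= ?eqxx ?orbT; auto. Qed.

Lemma conj_set_mul g h (A : set C) y :
  conj_set (g * h) A y <-> conj_set h A (g^-1 * y * g).
Proof. by rewrite !conj_setE invgM !mulgA. Qed.

Lemma starI_edge u v S : u <> v -> (forall i, S i -> star u i && star v i) ->
  exists i, S =1 edge i \/ (forall j, S j -> j = i).
Proof.
move=> uv sS; have [/existsP[i Si]|/existsPn S0] := boolP [exists i, S i]; last first.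
  by exists u; right=> j Sj; have := S0 j; rewrite Sj.
have [/existsP[j /andP[Sj ij]]|/existsPn S1] := boolP [exists j, S j && (j != i)]; last first.
  by exists i; right=> j Sj; have := S1 j; rewrite Sj /= negbK => /eqP.
have adj x y : S x -> S y -> x = y \/ adjz x y.
  by move=> /sS/andP[ux vx] /sS/andP[uy vy]; apply: starI uv _ _ _ _.
have adjij : adjz i j by case: (adj i j) => // e; rewrite e eqxx in ij.
have only (k : 'Z_n) : S k -> k = i \/ k = j.
  move=> Sk; case: (adj i k) => // [->|ik]; first by left.
  case: (adj j k) => // [->|jk]; first by right.
  by rewrite (adjz_triangle hn adjij jk) in ik.
case/orP: adjij => /eqP e; [exists i|exists j]; left=> k; apply/idP/idP.
- by move=> /only[->|->]; apply/edgeP; rewrite -?e; auto.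
- by move=> /edgeP[->|->] //; rewrite -e.
- by move=> /only[->|->]; apply/edgeP; rewrite -?e; auto.
- by move=> /edgeP[->|->] //; rewrite -e.
Qed.

(** Take the middle word of [para_conjI]. If it is empty, two stars of the cycle are compared.
    Otherwise its first letter lies outside the star of u and has at most one neighbour in that
    star. *)
Lemma star_conjI u v g :
  (u = v /\ para (star u) g) \/
  exists s S i, [/\ para (star u) s,
    para (star u) `&` conj_set g (para (star v)) = conj_set s (para S)
    & (u <> v /\ S =1 edge i) \/ (forall j, S j -> j = i)].
Proof.
have [s [w [t [us vt def_g lw defI]]]] := para_conjI (star u) (star v) g.
case: w def_g lw defI => [|l w] def_g lw defI.
  have [e|uv] := eqVneq u v.
    left; split=> //; rewrite def_g cyc_class_nil mulg1 -e in vt *.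
    exact: paraM.
  right; have /eqP uv' := uv.
  have sub i : [&& star u i, star v i & link ([::] : word) i] -> star u i && star v i.
    by move=> /and3P[-> ->].
  have [i H] := starI_edge uv' sub.
  exists s, [pred i | [&& star u i, star v i & link ([::] : word) i]], i; split=> //.
  by case: H => H; [left|right].
right; set S := [pred i | _] in defI.
have nul : ~~ star u (tag l).
  by apply/negP => ul; have := lw [::] l w erefl ul.
have [i Si|S0] := pickP S.
  exists s, S, i; split=> //; right=> j Sj.
  apply: (star_adjzI hn nul).
  - by case/and3P: Sj.
  - by case/and3P: Sj => _ _ /andP[]; rewrite adjzC.
  - by case/and3P: Si.
  - by case/and3P: Si => _ _ /andP[]; rewrite adjzC.
by exists s, S, u; split=> //; right=> j; rewrite S0.
Qed.

(** The index set that [para_conjI] gives for the intersection is nonempty, which forces v = w and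
    makes every letter of the middle word commute with G_v. *)
Lemma in_conj_para1 v (w : 'Z_n) (g a : C) : a <> 1 -> para (pred1 v) a ->
  conj_set g (para (pred1 w)) a -> v = w /\ para (star v) g.
Proof.
move=> nta va wa; have [s [x [t [vs vt def_g _ defI]]]] := para_conjI (pred1 v) (pred1 w) g.
have : (para (pred1 v) `&` conj_set g (para (pred1 w))) a by [].
rewrite defI; set S := [pred i | _] => /conj_setE Sa.
have [i /and3P[/eqP-> /eqP vw vx]|S0] := pickP S; last first.
  case: nta; have := para0 (fun i => negbT (S0 i)) Sa => e.
  by apply/(@mulgI _ s^-1)/(@mulIg _ s); rewrite e mulg1 mulVg.
split=> //; rewrite -vw in vt; rewrite def_g.
have v1 j : pred1 v j -> star v j by move=> /eqP->; apply: star_refl.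
apply: paraM; last exact: sub_para vt.
apply: paraM; first exact: sub_para vs.
apply/para_word; apply: sub_letters_in vx => j vj.
by rewrite /star vj orbT.
Qed.

Lemma para1_commute v (a x : C) : a <> 1 -> para (pred1 v) a -> commute a x -> para (star v) x.
Proof.
move=> nta va ax; suff /(in_conj_para1 nta va)[] : conj_set x (para (pred1 v)) a by [].
by apply/conj_setE; rewrite -mulgA ax mulKg.
Qed.

Hypothesis ntG : forall i, exists x : G i, x <> 1.

Lemma sub_conj_para S T g : para S `<=` conj_set g (para T) ->
  (forall i, S i -> T i) /\
  exists s w t, [/\ para S s, para T t, g = s * cyc_class w * t & forall i, S i -> link w i].
Proof.
move=> sST; have [s [w [t [Ss Tt def_g _ defI]]]] := para_conjI S T g.
suff sub i : S i -> [&& S i, T i & link w i].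
  by split=> [i /sub/and3P[]//|]; exists s, w, t; split=> // i /sub/and3P[].
move=> Si; have [x ntx] := ntG i.
have : para S (s * cyc_in x / s) by apply/paraM/paraV; first apply/paraM/para_in.
move=> Sx; have : (para S `&` conj_set g (para T)) (s * cyc_in x / s).
  by split=> //; apply: sST.
rewrite defI => /conj_setE.
by rewrite !mulgA mulVg mul1g mulgVK => /(para_inE ntx).
Qed.

(** The middle word commutes with both ends of an edge; these have no common neighbour in the cycle,
    so it is empty. *)
Lemma sub_edge_conj i T g : para (edge i) `<=` conj_set g (para T) ->
  [/\ T i, T (i + 1)%R & exists s t, [/\ para (edge i) s, para T t & g = s * t]].
Proof.
move=> /sub_conj_para[sT [s [w [t [Ss Tt def_g lw]]]]].
have ei : edge i i by apply/edgeP; left.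
have eSi : edge i (i + 1)%R by apply/edgeP; right.
split; [exact: sT|exact: sT|exists s, t; split=> //].
case: w def_g lw => [|l w] def_g lw; first by rewrite def_g cyc_class_nil mulg1.
have /andP[il _] := lw _ ei; have /andP[iSl _] := lw _ eSi.
have ii : adjz i (i + 1)%R by rewrite /adjz eqxx.
by have := adjz_triangle hn ii iSl; rewrite il.
Qed.

Lemma edge_inj i j : edge j i -> edge j (i + 1)%R -> i = j.
Proof.
move=> /edgeP[//|e1] /edgeP[e2|/addIr//].
have := (succ_ZnP hn _ _).1 e1; have := (succ_ZnP hn _ _).1 (esym e2).
by move=> ? ?; apply/eqZnP; lia.
Qed.

Lemma star_inj i j : (forall k : 'Z_n, star i k -> star j k) -> i = j.
Proof.
move=> sij; apply: contrapT => ne.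
have eS : ((i - 1) + 1)%R = i by rewrite subrK.
have s1 : star i (i + 1)%R by rewrite /star /adjz eqxx orbT.
have s2 : star i (i - 1)%R by rewrite /star /adjz eS eqxx !orbT.
have := @starI n hn _ _ (i + 1)%R (i - 1)%R ne s1 (sij _ s1) s2 (sij _ s2).
have := (succ_ZnP hn _ _).1 (erefl (i + 1)%R); have := (succ_ZnP hn _ _).1 (esym eS).
by rewrite adjzP // eqZnP; lia.
Qed.

Lemma conj_edge_eq i j g : conj_set g (para (edge j)) = para (edge i) ->
  i = j /\ para (edge i) g.
Proof.
move=> e; have /sub_edge_conj : para (edge i) `<=` conj_set g (para (edge j)) by rewrite e.
move=> [ij iSj [s [t [Ss Tt def_g]]]]; have ij' := edge_inj ij iSj.
by split=> //; rewrite def_g; apply: paraM => //; rewrite ij'.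
Qed.

Lemma sub_star_conj i j g : para (star i) `<=` conj_set g (para (star j)) ->
  i = j /\ para (star i) g.
Proof.
move=> /sub_conj_para[sT [s [w [t [Ss Tt def_g lw]]]]].
have ij := star_inj sT; split=> //; rewrite -ij in Tt.
case: w def_g lw => [|l w] def_g lw; first by rewrite def_g cyc_class_nil mulg1; apply: paraM.
have /andP[il _] := lw _ (star_refl i).
have /andP[iSl _] : link (l :: w) (i + 1)%R by apply: lw; rewrite /star /adjz eqxx orbT.
have ii : adjz i (i + 1)%R by rewrite /adjz eqxx.
by have := adjz_triangle hn ii iSl; rewrite il.
Qed.
End Parabolics.

(** * Subgroups that split as a product *)

Section Hyperbolic.
Variables (n : nat) (hn : (5 <= n)%N) (G : 'Z_n -> groupType).
Local Notation C := (cyclic_product G).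
Local Notation word := (seq (letter G)).
Implicit Types (i j u v : 'Z_n) (S T : pred 'Z_n) (l m : letter G) (w : word).
Implicit Types (g h a b : C) (Q : set C).

(** The conjugate by g of a star subgroup is the stabiliser of a wall under left multiplication.
    Elements that are not [in_star] stabilise no wall and play the role of hyperbolic isometries. *)
Definition in_star a := exists g v, conj_set g (para (star v)) a.

Definition wpow N w : word := flatten (nseq N w).

Lemma cyc_class_wpow N w : cyc_class (wpow N w) = cyc_class w ^+ N.
Proof. by elim: N => [//|N IHN]; rewrite /wpow /= cyc_class_cat IHN expgS. Qed.

Lemma wpowD M N w : wpow (M + N) w = wpow M w ++ wpow N w.
Proof. by rewrite /wpow nseqD flatten_cat. Qed.

Lemma wpow_prefix N w c m q : wpow N w = c ++ m :: q ->
  exists j k : nat, (k < size w)%N /\ c = wpow j w ++ take k w.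
Proof.
elim: N c => [|N IHN] c; first by case: c.
rewrite /wpow /= => e; case: (cat_cons_split e) => [[d -> _]|[d def_d ->]].
  exists 0%N, (size c); rewrite size_cat /=; split; first lia.
  by rewrite take_size_cat.
have [j [k [ltk ->]]] := IHN _ def_d; exists j.+1, k; split=> //.
by rewrite /wpow /= catA.
Qed.

(* A shortest word in the conjugacy class of a works: two letters of its      *)
(* square that could be merged could also be merged after a conjugation,     *)
(* unless the whole word commutes with one of its letters.                   *)
Lemma reduced_powers a : ~ in_star a ->
  exists g w, cyc_class w = g^-1 * a * g /\ forall N, reduced (wpow N w).
Proof.
move=> na; have [|w [g def_w] min_w] := @min_word _ G (fun w => exists g, cyc_class w = g^-1 * a * g).
  by exists (cyc_word a), 1; rewrite cyc_wordK invg1 mul1g mulg1.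
exists g, w; split=> //.
have nstar v : ~ letters_in (star v) w.
  by move=> vw; apply: na; exists g, v; rewrite conj_setE -def_w; apply: para_word.
have redw : reduced w.
  by apply: min_reduced => w' def_w'; apply: min_w; exists g; rewrite def_w'.
have apart w1 l w2 x1 m x2 : w = w1 ++ l :: w2 -> w = x1 ++ m :: x2 -> tag l = tag m ->
    ~~ letters_in (star (tag l)) (w2 ++ x1).
  move=> def1 def2 tlm; apply/negP; rewrite letters_in_cat => /andP[ov2 ov1].
  have : x1 ++ m :: x2 = w1 ++ l :: w2 by rewrite -def1.
  move=> e; case: (cat_cons_split e) => [[c defx1 def_w2]|[[|m' c] defc defw1]].
  - apply: (nstar (tag l)); rewrite def2 letters_in_cat ov1.
    by move: ov2; rewrite def_w2 letters_in_cat => /andP[].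
  - case: defc => defm defx2; apply: (nstar (tag l)); rewrite def1 letters_in_cat /= star_refl.
    by rewrite defw1 cats0 ov1.
  have {}defc : x2 = c ++ l :: w2 by case: defc.
  have [||x [w' ltw' [_ def_m _]]] := @star_mergeW _ _ (tag l) (w2 ++ x1) m [::].
  - by rewrite !letters_in_cat ov1 ov2 /= tlm star_refl.
  - by [].
  suff /min_w : exists g, cyc_class (c ++ mk_letter (tagged l * x) :: w') = g^-1 * a * g.
    move: ltw'; rewrite def2 defc !size_cat /= !size_cat /=; lia.
  exists (g * cyc_class (x1 ++ [:: m])).
  set y := cyc_class (x1 ++ [:: m]).
  have -> : (g * y)^-1 * a * (g * y) = y^-1 * cyc_class w * y.
    by rewrite def_w invgM !mulgA.
  have -> : cyc_class w = y * cyc_class (c ++ l :: w2).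
    by rewrite -cyc_class_cat def2 defc -catA.
  rewrite mulKg cyc_class_cat (cyc_class_cons _ w') cyc_in_letter cyc_inM -(mulgA (cyc_in _)).
  rewrite -def_m -catA (cyc_class_cat w2) -/y (cyc_class_cat c) (cyc_class_cons l).
  by rewrite (cyc_in_letter l) !mulgA.
elim=> [|N IHN]; first by split=> [[]|[]].
split=> [w1 l w2|w1 l w2 m w3]; rewrite /wpow /= => e.
  by case: (cat_cons_split e) => [[c def_w' _]|[c def_w' _]];
    [exact: redw.1 def_w'|exact: IHN.1 def_w'].
case: (cat_cons_split e) => [[c def1 def2] tlm|[c def1 _]]; last exact: IHN.2 def1.
case: (cat_cons_split (esym def2)) => [[d def_c _]|[d def_d ->]].
  by apply: (redw.2 w1 l w2 m d) => //; rewrite def1 def_c.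
case: N {IHN e def2} def_d => [|N] def_d; first by case: d def_d.
case: (cat_cons_split def_d) => [[x def3 _]|[x def3 ->]].
  exact: apart def1 def3 tlm.
apply/negP; rewrite !letters_in_cat => /and3P[_ ow _]; exact: nstar ow.
Qed.

Lemma reduced_power_star w v N : reduced (wpow N.+1 w) ->
  para (star v) (cyc_class w ^+ N.+1) -> letters_in (star v) w.
Proof.
move=> red; rewrite -cyc_class_wpow => /(reduced_para red).
by rewrite letters_in_cat => /andP[].
Qed.

Lemma conj_exp g a N : (g^-1 * a * g) ^+ N = g^-1 * a ^+ N * g.
Proof. by have := conjXg a g N; rewrite !conjgE !mulgA => ->. Qed.

Lemma not_in_star_exp a N : ~ in_star a -> a ^+ N.+1 <> 1.
Proof.
move=> na aN; have [g [w [def_w red]]] := reduced_powers na.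
apply: na; exists g, 0%R; rewrite conj_setE -def_w; apply: para_word.
apply: reduced_power_star (red N.+1) _.
by rewrite def_w conj_exp aN mulg1 mulVg; apply: para1.
Qed.

Lemma eventually_not (R : nat -> C -> Prop) :
  (forall h (i j : nat), R i h -> R j h -> i = j) ->
  forall F : seq C, exists M : nat, forall (i : nat) h, (M <= i)%N -> h \in F -> ~ R i h.
Proof.
move=> uR; elim=> [|h F [M IHF]]; first by exists 0%N.
have [[i Ri]|nR] := pselect (exists i : nat, R i h).
  exists (maxn M i.+1) => j k; rewrite geq_max in_cons => /andP[Mj ij] /predU1P[->|Fk].
    by move=> Rj; rewrite (uR _ _ _ Ri Rj) ltnn in ij.
  exact: IHF.
exists M => j k Mj; rewrite in_cons => /predU1P[->|Fk]; last exact: IHF.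
by move=> Rj; apply: nR; exists j.
Qed.

(* The walls a^i St(v) separate 1 from a^N for all i < N, so b a^N b^-1 crosses *)
(* them as well. Both b and b^-1 cross only boundedly many of them; any other  *)
(* one is crossed within the translate b a^N of the axis of a.                 *)
Lemma wall_translate l w' (w := l :: w') (v := tag l) (a := cyc_class w) b :
  (forall N, reduced (wpow N w)) -> ~ letters_in (star v) w -> commute a b ->
  exists i j k : nat, (k < size w)%N /\
    para (star v) (a ^- i * b * a ^+ j * cyc_class (take k w)).
Proof.
move=> red nv ab.
have nst (d : nat) : ~ para (star v) (a ^+ d.+1).
  exact: contra_not (reduced_power_star (red _)) nv.
have uniq_exp (i j : nat) : para (star v) (a ^- i * a ^+ j) -> i = j.
  have [lt_ij|lt_ji|//] := ltngtP i j.
    rewrite -(subnKC (ltnW lt_ij)) expgnDr mulKg.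
    by case: (j - i) (subn_gt0 i j) => [|d _ /nst//]; rewrite lt_ij.
  move=> /paraV; rewrite invgM invgK.
  rewrite -(subnKC (ltnW lt_ji)) expgnDr mulKg.
  by case: (i - j) (subn_gt0 j i) => [|d _ /nst//]; rewrite lt_ji.
pose B := cyc_word b.
(* The prefixes met while reading the two ends of B a^N B^-1. For the second end, b a^N = a^N b is
   used, which puts [b] in front. *)
pose F := [seq cyc_class (take k B) | k <- iota 0 (size B).+1] ++
          [seq b * cyc_class (take k (inv_word B)) | k <- iota 0 (size B).+1].
have [|M1 HM1] := @eventually_not (fun (i : nat) h => para (star v) (a ^- i * h)) _ F.
  move=> h i j hi hj; apply: uniq_exp; have := paraM hi (paraV hj).
  by rewrite invgM invgK !mulgA mulgK.
have [|M2 HM2] := @eventually_not (fun (i : nat) h => para (star v) (a ^+ i * h)) _ F.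
  move=> h i j hi hj; apply/esym/uniq_exp; have := paraM hi (paraV hj).
  rewrite invgM mulgA mulgK; suff -> : a ^- j * a ^+ i = a ^+ i / a ^+ j by [].
  by apply/esym/commuteV/commuteX2.
(* The wall a^M1 St(v) is then out of reach of both ends: M1 steps after the start of the axis and
   M2 + 1 steps before its end. *)
set N := (M1 + M2.+1)%N.
have aN : cyc_class (B ++ wpow N w ++ inv_word B) = cyc_class (wpow N w).
  rewrite !cyc_class_cat cyc_class_inv cyc_wordK cyc_class_wpow -/a mulgA.
  by rewrite (commuteX N (commute_sym ab)) mulgK.
have aM1 : cyc_class (wpow M1 w) = a ^+ M1 by rewrite cyc_class_wpow.
have := @cross_reduced _ _ (wpow M1 w) l (w' ++ wpow M2 w).
have -> : wpow M1 w ++ l :: w' ++ wpow M2 w = wpow N w.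
  by rewrite /N wpowD; congr (_ ++ _).
move=> /(_ (red N)) crossN.
have /cross_neq1[p [m [q [def_p tm]]]] :
    cross v (wall v (a ^+ M1)) 1 (B ++ wpow N w ++ inv_word B) <> 1.
  rewrite (@cross_class _ _ _ _ _ _ _ (@wall_stable _ _ _ _) aN) -aM1 crossN.
  by apply: ((red 1%N).1 [::]).
rewrite /wall /= mul1g => hp.
case: (cat_cons_split def_p) => [[c def_B _]|[c def_c def_p']].
  case: (HM1 M1 (cyc_class p)) => //; rewrite mem_cat; apply/orP; left.
  apply/mapP; exists (size p); last by rewrite def_B take_size_cat.
  by rewrite mem_iota add0n /= def_B size_cat; lia.
rewrite def_p' in hp; case: (cat_cons_split def_c) => [[d def_N _]|[d def_d def_c']].
  have [j [k [ltk def_c']]] := wpow_prefix def_N.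
  exists M1, j, k; split=> //; move: hp; rewrite def_c' !cyc_class_cat cyc_wordK.
  by rewrite cyc_class_wpow !mulgA.
case: (HM2 M2.+1 (b * cyc_class d)) => //.
  rewrite mem_cat; apply/orP; right; apply/mapP; exists (size d).
    have /(congr1 size) : inv_word B = d ++ m :: q by [].
    rewrite mem_iota add0n /= size_rev size_map size_cat /=; lia.
  by rewrite def_d take_size_cat.
move: hp; rewrite def_c' !cyc_class_cat cyc_wordK cyc_class_wpow.
rewrite (mulgA b) (commuteX N (commute_sym ab)) /N expgnDr -!mulgA mulKg.
by rewrite !mulgA.
Qed.

Lemma star_conjI_same v g a : ~ para (star v) g -> para (star v) a ->
  conj_set g (para (star v)) a -> exists h i, conj_set h (para (pred1 i)) a.
Proof.
move=> ng va ga; case: (star_conjI hn v v g) => [[_ //]|[s [S [i [_ defI HS]]]]].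
have {}HS : forall j, S j -> j = i by case: HS => // -[].
exists s, i; suff sub : conj_set s (para S) `<=` conj_set s (para (pred1 i)).
  by apply: sub; rewrite -defI.
by apply/conj_setS/sub_para => j /HS->; apply: eqxx.
Qed.

Lemma vertex_commute g v a b : a <> 1 -> conj_set g (para (pred1 v)) a -> commute a b ->
  conj_set g (para (star v)) b.
Proof.
rewrite !conj_setE => nta va ab; apply: para1_commute va _ => //.
  move=> e; apply: nta; apply: (@mulgI _ g^-1); apply: (@mulIg _ g).
  by rewrite e mulg1 mulVg.
by have := gmulf_commute; rewrite /commute -!mulgA !mulVKg (mulgA a) ab !mulgA.
Qed.

Lemma in_star_conj g a : in_star (g^-1 * a * g) -> in_star a.
Proof. by move=> [h [v vh]]; exists (g * h), v; rewrite conj_set_mul. Qed.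

(** For two elements of the shape found in [wall_translate] with the same tail [h], the tail cancels
    in the quotient and commutation collects the powers. *)
Lemma commute_rearrange a b h (i j i' j' p r : nat) : commute a b ->
  a ^- i' * b ^+ (p + r) * a ^+ j' * h * (a ^- i * b ^+ p * a ^+ j * h)^-1 =
  b ^+ r * (a ^+ (j' + i) / a ^+ (i' + j)).
Proof.
move=> ab; have aa x y : commute (a ^+ x) (a ^+ y) by apply: commuteX2.
have ba x y : commute (b ^+ x) (a ^+ y) by apply/commuteX2/commute_sym.
rewrite !invgM !invgK !mulgA mulgK -(mulgA _ (a ^+ j')) -(mulgA _ _ (b ^- p)).
have -> : a ^+ j' / a ^+ j / b ^+ p = b ^- p * (a ^+ j' / a ^+ j).
  apply/esym/commuteM; last apply/commuteV; apply/commute_sym/commuteV/commute_sym; exact: ba.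
rewrite addnC expgnDr !mulgA -(mulgA _ (b ^+ p)) mulgV mulg1.
have -> : a ^- i' * b ^+ r = b ^+ r * a ^- i' by apply/esym/commuteV/ba.
rewrite -!mulgA; congr (_ * _); rewrite !expgnDr invgM !mulgA.
have Va x y : commute (a ^- x) (a ^+ y) by apply/commute_sym/commuteV/aa.
rewrite -(mulgA _ (a ^- j)) (Va j i) -!mulgA.
have c : commute (a ^- i') (a ^+ j' * (a ^+ i * a ^- j)).
  by do !apply: commuteM => //; apply: commuteV.
by rewrite (c : _ = _) -!mulgA.
Qed.

(* The translates of St(v) by powers of b lie in finitely many orbits under a, *)
(* so some b^r a^q with r > 0 fixes the wall St(v); commuting with a, it also  *)
(* fixes a St(v), hence it is trivial.                                         *)
Lemma common_power a b : ~ in_star a -> commute a b ->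
  exists r k m : nat, b ^+ r.+1 = a ^+ k / a ^+ m.
Proof.
move=> na ab; have [g [w [def_w red]]] := reduced_powers na.
case: w def_w red => [|l w'] def_w red.
  case: na; exists g, 0%R; rewrite conj_setE -def_w; exact: para1.
have {}na : ~ in_star (cyc_class (l :: w')).
  by apply: contra_not na; rewrite def_w; apply: in_star_conj.
set v := tag l; set w := l :: w' in def_w red.
have nv : ~ letters_in (star v) w.
  by move=> vw; apply: na; exists 1, v; rewrite conj_set1; apply: para_word.
suff [r [k [m e]]] : exists r k m : nat,
    (g^-1 * b * g) ^+ r.+1 = cyc_class w ^+ k / cyc_class w ^+ m.
  exists r, k, m; apply: (@mulgI _ g^-1); apply: (@mulIg _ g).
  by rewrite -conj_exp e def_w !conj_exp !invgM invgK !mulgA mulgK.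
have {}ab : commute (cyc_class w) (g^-1 * b * g).
  by rewrite def_w /commute !mulgA !mulgK -!mulgA (mulgA a) ab !mulgA.
move: (g^-1 * b * g) ab => {}b; set d := cyc_class w in na *; move=> ab.
have /choice[f Hf] p : exists x : nat * nat * nat, (x.2 < size w)%N /\
    para (star v) (d ^- x.1.1 * b ^+ p * d ^+ x.1.2 * cyc_class (take x.2 w)).
  have /(wall_translate red nv) : commute (cyc_class w) (b ^+ p).
    exact: commuteX.
  by move=> [i [j [k [ltk H]]]]; exists (i, j, k).
(* Pigeonhole on the length of the partial period of [w], which takes at most [size w] values. *)
have [p [r e]] : exists p r : nat, (f p).2 = (f (p + r.+1)%N).2.
  pose F (p : 'I_(size w).+1) := Ordinal (proj1 (Hf p)).
  have /injectivePn[p [q neq /(congr1 val)/= e]] : ~~ injectiveb F.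
    by apply/negP => /injectiveP/leq_card; rewrite !card_ord ltnn.
  have [ltpq|ltqp|/val_inj epq] := ltngtP p q; last by rewrite epq eqxx in neq.
    by exists p, (q - p.+1)%N; rewrite e -addSnnS subnKC.
  by exists q, (p - q.+1)%N; rewrite -e -addSnnS subnKC.
have [_ Hx] := Hf p; have [_ Hy] := Hf (p + r.+1)%N.
have := paraM Hy (paraV Hx); rewrite e commute_rearrange //.
set k := (_ + _)%N; set m := (_ + _)%N; set c := b ^+ _ * _ => vc.
have ca : commute d c.
  apply: commuteM; first exact: commuteX.
  by apply: commuteM; [|apply: commuteV]; apply: commuteX.
have [c1|ntc] := pselect (c = 1).
  exists r, m, k; apply/divg1_eq.
  by rewrite invgF.
have [|//||h [i hc]] := @star_conjI_same v d c.
- move=> vd; apply: nv; apply: reduced_power_star (red 1%N) _.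
  exact: vd.
- by rewrite conj_setE;  rewrite -mulgA -ca mulKg.
case: na; exists h, i; apply: vertex_commute hc _ => //.
Qed.

(** Conjugation by [b] fixes [a], so [a] also lies in the star subgroup conjugated by b g. Were this
    another conjugate, [star_conjI_same] would put [a] in a conjugate of some G_i. *)
Lemma star_centraliser g v a b : ~ (exists h i, conj_set h (para (pred1 i)) a) ->
  conj_set g (para (star v)) a -> commute a b -> conj_set g (para (star v)) b.
Proof.
move=> nva ga ab; rewrite conj_setE; apply: contrapT => nb; apply: nva.
have [//|||h [i hi]] := @star_conjI_same v (g^-1 * b * g) (g^-1 * a * g).
- by move: ga; rewrite conj_setE.
- rewrite conj_setE; move: ga; rewrite conj_setE.
  suff -> : (g^-1 * b * g)^-1 * (g^-1 * a * g) * (g^-1 * b * g) = g^-1 * a * g by [].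
  by rewrite !invgM invgK !mulgA !mulgK -!mulgA (mulgA a) ab -(mulgA b) mulKg.
by exists (g * h), i; rewrite conj_set_mul.
Qed.

Lemma conj_star_para1 v g : para (star v) g ->
  conj_set g (para (pred1 v)) = para (pred1 v).
Proof.
pose N : set C := [set g | conj_set g (para (pred1 v)) = para (pred1 v)].
suff : para (star v) `<=` N by apply.
apply: para_min => [|i x vi].
  split=> [|h k Nh Nk]; first exact: conj_set1.
  rewrite /N /= conj_setM -[in LHS]Nk conj_setK; exact: Nh.
have [e|ne] := eqVneq i v; first by apply: conj_para; apply: para_in; rewrite /= e.
have vi' : adjz v i by move: vi; rewrite /star eq_sym (negbTE ne).
have c y : para (pred1 v) y -> cyc_in x * y = y * cyc_in x.
  apply: (@para_commute _ _ (pred1 i) (pred1 v)) => [j k|]; last exact/para_in/eqxx.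
  by move=> /eqP-> /eqP->; rewrite adjzC.
apply/seteqP; split=> [_ [y vy <-]|y vy]; first by rewrite c // mulgK.
by exists y => //; rewrite c // mulgK.
Qed.

Lemma edge_vertex i a h v : para (edge i) a -> conj_set h (para (pred1 v)) a ->
  para (pred1 i) a \/ para (pred1 (i + 1)%R) a.
Proof.
move=> ia va; have [s [w [t [is_ _ _ _ defI]]]] := para_conjI (edge i) (pred1 v) h.
have : (para (edge i) `&` conj_set h (para (pred1 v))) a by [].
rewrite defI conj_setE => sa.
have norm j : edge i j -> para (pred1 j) (s^-1 * a * s) -> para (pred1 j) a.
  move=> ij; rewrite -conj_setE conj_star_para1 //.
  by apply: sub_para is_ => k; move: ij => /edgeP[->|->]; [apply: edge_star|apply: edge_starS].
have sub : para (pred1 v) (s^-1 * a * s) by apply: sub_para sa => j /and3P[].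
have [iv|niv] := boolP (edge i v).
  by case: (edgeP i v).1 (iv) => [|ev|ev] // /norm/(_ sub); rewrite ev; auto.
left; have -> : a = 1; last exact: para1.
apply: (@mulgI _ s^-1); apply: (@mulIg _ s); rewrite mulg1 mulVg.
apply: para0 sa => j; apply/negP => /and3P[ij /eqP ev _].
by rewrite -ev ij in niv.
Qed.

Lemma nontrivial_elt (A : set C) : is_subgroup A -> A <> @trivial_subgroup C ->
  exists a, A a /\ a <> 1.
Proof.
move=> [A1 _]; apply: contra_notP => nA; apply/seteqP; split=> [a Aa|_ ->//].
by apply: contrapT => nta; apply: nA; exists a.
Qed.

Definition in_vertex a := exists g v, conj_set g (para (pred1 v)) a.

Lemma star_of a : in_star a -> a <> 1 -> exists g v,
  conj_set g (para (star v)) a /\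
  forall b, commute a b -> conj_set g (para (star v)) b.
Proof.
move=> [g [v ga]] nta; have [[h [i ha]]|nva] := pselect (in_vertex a).
  exists h, i; split; last by move=> b; apply: vertex_commute.
  exact: vertex_commute nta ha (commute_refl a).
by exists g, v; split=> // b; apply: star_centraliser.
Qed.

Lemma subgroup_exp (A : set C) a (k : nat) : is_subgroup A -> A a -> A (a ^+ k).
Proof.
move=> [A1 AF] Aa; elim: k => [//|k IHk]; rewrite expgS -(invgK (a ^+ k)).
by apply: (AF) => //; rewrite -div1g; apply: AF.
Qed.

(** Otherwise [common_power] gives a positive power of [b] lying in A and B, hence trivial. Then [b]
    has torsion, so it is in a star by [not_in_star_exp], and so is its centraliser, which contains
    [a]. *)
Lemma factor_in_star (A B : set C) b : is_subgroup A -> is_subgroup B ->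
  (forall x y, A x -> B y -> x * y = y * x) -> A `&` B = @trivial_subgroup C ->
  B b -> b <> 1 -> forall a, A a -> in_star a.
Proof.
move=> sgA sgB cAB tiAB Bb ntb a Aa; apply: contrapT => na.
have ab : commute a b by apply: cAB.
have [r [k [m def_br]]] := common_power na ab.
have br1 : b ^+ r.+1 = 1.
  have : (A `&` B) (b ^+ r.+1).
    split; last exact: subgroup_exp.
    by rewrite def_br; apply: sgA.2; apply: subgroup_exp.
  by rewrite tiAB.
have sb : in_star b.
  by apply: contrapT => nb; case: (@not_in_star_exp b r nb).
have [g [v [_ cb]]] := star_of sb ntb.
by apply: na; exists g, v; apply/cb/commute_sym.
Qed.

(** If a factor has an element in no conjugate of any G_i, then by [star_centraliser] a star
    conjugate containing that factor also contains the other one. What remains is the case where all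
    elements of A and B are conjugate into some G_i. *)
Lemma splits_sub_star H : splits_as_product H ->
  exists g v, H `<=` conj_set g (para (star v)).
Proof.
move=> [_ [A [B [[sgA sgB] [ntA ntB] cAB tiAB ->]]]].
have cBA x y : B x -> A y -> x * y = y * x by move=> *; apply/esym/cAB.
have tiBA : B `&` A = @trivial_subgroup C by rewrite setIC.
have [a0 [Aa0 nta0]] := nontrivial_elt sgA ntA.
have [b0 [Bb0 ntb0]] := nontrivial_elt sgB ntB.
have starA := factor_in_star sgA sgB cAB tiAB Bb0 ntb0.
have starB := factor_in_star sgB sgA cBA tiBA Aa0 nta0.
suff [g [v [Ag Bg]]] : exists g v,
    A `<=` conj_set g (para (star v)) /\ B `<=` conj_set g (para (star v)).
  exists g, v => _ [x /Ag gx [y /Bg gy <-]]; move: gx gy; rewrite !conj_setE => gx gy.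
  by have := paraM gx gy; rewrite !mulgA mulgK.
have [[a [Aa na]]|allA] := pselect (exists a, A a /\ ~ in_vertex a).
  have [g [v [gb cb]]] := star_of (starB _ Bb0) ntb0.
  have Ag : A `<=` conj_set g (para (star v)) by move=> x Ax; apply/cb/cBA.
  by exists g, v; split=> // y By; apply: (star_centraliser na) (Ag _ Aa) (cAB _ _ Aa By).
have [[b [Bb nb]]|allB] := pselect (exists b, B b /\ ~ in_vertex b).
  have [g [v [ga ca]]] := star_of (starA _ Aa0) nta0.
  have Bg : B `<=` conj_set g (para (star v)) by move=> x Bx; apply/ca/cAB.
  by exists g, v; split=> // y Ay; apply: (star_centraliser nb) (Bg _ Bb) (cBA _ _ Bb Ay).
have vA a : A a -> in_vertex a by move=> Aa; apply: contrapT => na; apply: allA; exists a.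
have vB b : B b -> in_vertex b by move=> Bb; apply: contrapT => nb; apply: allB; exists b.
have sub1 g v : conj_set g (para (pred1 v)) `<=` conj_set g (para (star v)).
  by apply/conj_setS/sub_para => i /eqP->; apply: star_refl.
have [g [v gb0]] := vB _ Bb0.
have Ag : A `<=` conj_set g (para (star v)).
  by move=> a Aa; apply: vertex_commute ntb0 gb0 (cBA _ _ Bb0 Aa).
have [Bg|] := pselect (B `<=` conj_set g (para (pred1 v))).
  by exists g, v; split=> // b /Bg/sub1.
move=> /existsNP[b /not_implyP[Bb ngb]].
have ntb : b <> 1.
  by move=> b1; apply: ngb; rewrite conj_setE b1 mulg1 mulVg; apply: para1.
have [g' [v' gb]] := vB _ Bb.
have Ag' : A `<=` conj_set g' (para (star v')).
  by move=> a Aa; apply: vertex_commute ntb gb (cBA _ _ Bb Aa).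
(* The two star conjugates around A differ: St(v) normalises G_v, while [b] lies outside the first
   conjugate of G_v. *)
have [f [i Af]] : exists f i, A `<=` conj_set f (para (edge i)).
  have [[ev vg]|[s [S [i [vs defI HS]]]]] := star_conjI hn v v' (g^-1 * g').
    case: ngb; rewrite -(conj_star_para1 vg) -conj_setM mulVKg ev; exact: gb.
  exists (g * s), i => a Aa; rewrite conj_set_mul.
  have : (para (star v) `&` conj_set (g^-1 * g') (para (star v'))) (g^-1 * a * g).
    split; first by rewrite -conj_setE; apply: Ag.
    by rewrite -(conj_set_mul g) mulVKg; apply: Ag'.
  rewrite defI; apply: conj_setS; apply: sub_para => j.
  case: HS => [[_ HS]|HS] Sj; first by rewrite -HS.
  by apply/edgeP; left; apply: HS.
have dich a : A a -> para (pred1 i) (f^-1 * a * f) \/ para (pred1 (i + 1)%R) (f^-1 * a * f).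
  move=> Aa; have [h [k hk]] := vA _ Aa.
  apply: (@edge_vertex _ _ (f^-1 * h) k); first by rewrite -conj_setE; apply: Af.
  by rewrite -(conj_set_mul f) mulVKg.
(* Comparing [a], [a0] and [a * a0] puts all of A in the factor containing [a0]; the centraliser of
   [a0] then bounds B. *)
have claim j k : j != k ->
    (forall a, A a -> para (pred1 j) (f^-1 * a * f) \/ para (pred1 k) (f^-1 * a * f)) ->
    para (pred1 j) (f^-1 * a0 * f) -> exists g v,
    A `<=` conj_set g (para (star v)) /\ B `<=` conj_set g (para (star v)).
  move=> jk djk ja0; exists f, j; split; last first.
    move=> y By; apply: vertex_commute nta0 _ (cAB _ _ Aa0 By).
    by rewrite conj_setE.
  move=> a Aa; apply: sub1; rewrite conj_setE; case: (djk _ Aa) => // ka.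
  have e : f^-1 * (a * a0) * f = (f^-1 * a * f) * (f^-1 * a0 * f).
    by rewrite !mulgA mulgK.
  have AM : A (a * a0).
    by rewrite -(invgK a0); apply: sgA.2 => //; rewrite -div1g; apply: sgA.2 => //; apply: sgA.1.
  case: (djk _ AM); rewrite e; first by rewrite paraMr.
  rewrite paraMl // => ka0.
  have := paraI ja0 ka0 => /para0 e0; case: nta0.
  apply: (@mulgI _ f^-1); apply: (@mulIg _ f); rewrite mulg1 mulVg; apply: e0 => x /=.
  by apply/negP => /andP[/eqP-> ejk]; rewrite ejk in jk.
have ii : i != (i + 1)%R by rewrite eq_sym succ_neq.
case: (dich _ Aa0); first exact: (claim _ (i + 1)%R).
apply: (claim _ i); first by rewrite eq_sym.
by move=> a /dich[]; auto.
Qed.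
End Hyperbolic.

(** * The collection C *)

Section Collection.
Variables (n : nat) (hn : (5 <= n)%N) (G : 'Z_n -> groupType).
Hypothesis ntG : forall i : 'Z_n, exists x : G i, x <> 1.
Local Notation C := (cyclic_product G).
Implicit Types (i j u v : 'Z_n) (S T : pred 'Z_n) (g h : C) (H K L : set C).

Lemma join_sub H K L : is_subgroup L -> H `<=` L -> K `<=` L -> join_subgroup H K `<=` L.
Proof. by move=> sgL HL KL; apply: smallest_sub => // x [/HL|/KL]. Qed.

Lemma join_subl H K : H `<=` join_subgroup H K.
Proof. by move=> x Hx L [_ sub]; apply: sub; left. Qed.

Lemma join_subr H K : K `<=` join_subgroup H K.
Proof. by move=> x Kx L [_ sub]; apply: sub; right. Qed.

Lemma join_is_subgroup H K : is_subgroup (join_subgroup H K).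
Proof.
split=> [L [[]]//|x y Jx Jy L sL].
by apply: sL.1.2; [apply: Jx | apply: Jy].
Qed.

Lemma vertex_groupE i : vertex_group G i = para (edge i).
Proof.
apply/seteqP; split.
  by apply: join_sub; [exact: para_subgroup| |];
    move=> _ [x _ <-]; apply: para_in; apply/edgeP; auto.
apply: para_min => [|j x /edgeP ej]; first exact: join_is_subgroup.
case: ej => e; subst; [apply: join_subl|apply: join_subr]; by exists x.
Qed.

Lemma para_nontrivial S i : S i -> para S <> @trivial_subgroup C.
Proof.
move=> Si; have [x ntx] := ntG i => e.
have : para S (cyc_in x) by apply: para_in.
by rewrite e => x1; apply/ntx/(@cyc_in_inj _ G); rewrite cyc_in1.
Qed.

Lemma para_trivial S : (forall i, ~~ S i) -> para S = @trivial_subgroup C.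
Proof.
by move=> S0; apply/seteqP; split=> [x /(para0 S0)//|_ ->]; apply: para1.
Qed.

Lemma sub_paraE S T : para S `<=` (para T : set C) -> forall i, S i -> T i.
Proof.
move=> sST i Si; have [x ntx] := ntG i.
by apply: (para_inE ntx); apply/sST/para_in.
Qed.

Lemma conj_subE g h H K : conj_set g H `<=` conj_set h K <-> H `<=` conj_set (g^-1 * h) K.
Proof. by rewrite -{1}(mulVKg g h) conj_setM; apply: conj_setSE. Qed.

Lemma star_splits v : splits_as_product (para (star v) : set C).
Proof.
split; first exact: para_subgroup.
exists (para (pred1 v)), (para (adjz v)); split.
- by split; apply: para_subgroup.
- split; first by apply: (@para_nontrivial _ v); apply: eqxx.
  by apply: (@para_nontrivial _ (v + 1)%R); rewrite /adjz eqxx.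
- by move=> x y vx vy; apply: para_commute vx vy => i j /eqP->.
- apply/seteqP; split=> [x [vx /(paraI vx)]|_ ->]; last by split; apply: para1.
  move=> /para0; apply=> i; apply/negP => /andP[/eqP-> ]; by rewrite adjz_irr.
apply/seteqP; split=> [_ [w /star_merge[ov [x e]] <-]|_ [x vx [y vy <-]]].
  exists (cyc_in x); first by apply: para_in; apply: eqxx.
  by exists (cyc_class [seq l <- w | tag l != v]); first exact: para_word.
apply: paraM; first by apply: sub_para vx => i /eqP->; apply: star_refl.
by apply: sub_para vy => i vi; rewrite /star vi orbT.
Qed.

Lemma max_productsP H : max_products H <-> exists g v, H = conj_set g (para (star v)).
Proof.
split=> [[spH maxH]|[g [v ->]]].
  have [g [v sHg]] := splits_sub_star hn spH; exists g, v.
  by apply/esym/maxH => //; apply/conj_splits/star_splits.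
split=> [|K /(splits_sub_star hn)[h [u sKh]] sgK]; first exact/conj_splits/star_splits.
have /conj_subE/(sub_star_conj hn ntG)[evu vgh] := subset_trans sgK sKh.
apply/seteqP; split=> // x /sKh.
by rewrite -{1}(mulVKg g h) conj_setM -evu conj_para.
Qed.

Lemma star_starS i j : star i j -> star (i + 1)%R j -> edge i j.
Proof.
have := (succ_ZnP hn _ _).1 (erefl (i + 1)%R); rewrite edgeP !starP !adjzP // !eqZnP.
have := ltZn hn i; have := ltZn hn j; lia.
Qed.

Lemma star_starSS i j : star i j -> star (i + 1 + 1)%R j -> j = (i + 1)%R.
Proof.
have := (succ_ZnP hn _ _).1 (erefl (i + 1)%R).
have := (succ_ZnP hn _ _).1 (erefl (i + 1 + 1)%R); rewrite !starP !adjzP // !eqZnP.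
have := ltZn hn i; have := ltZn hn j; lia.
Qed.

Lemma paraIE S T : para S `&` para T = para (predI S T) :> set C.
Proof.
apply/seteqP; split=> [x [Sx Tx]|x STx]; first exact: paraI.
by split; apply: sub_para STx => i /andP[].
Qed.

(** An edge is the intersection of the stars of its two ends, and {i} that of the stars of i - 1 and
    i + 1; [star_conjI] allows no other nontrivial intersections. *)
Lemma coll_CP H : coll_C H <-> exists g i, [\/ H = conj_set g (para (star i)),
  H = conj_set g (para (edge i)) | H = conj_set g (para (pred1 i))].
Proof.
split=> [[ntH [_ [_ [/max_productsP[g [u ->]] /max_productsP[h [v ->]] defH]]]]|].
  have {}defH : H = conj_set g (para (star u) `&` conj_set (g^-1 * h) (para (star v))).
    by rewrite defH conj_setI -conj_setM mulVKg.
  have [[euv ugh]|[s [S [i [us defI HS]]]]] := star_conjI hn u v (g^-1 * h).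
    by exists g, u; constructor 1; rewrite defH -euv conj_para // setIid.
  exists (g * s), i; rewrite defI -conj_setM in defH.
  case: HS => [[_ /eq_para eS]|HS]; first by constructor 2; rewrite defH eS.
  constructor 3; rewrite defH; congr conj_set; apply: eq_para => j.
  apply/idP/eqP => [/HS//|->]; apply: contrapT => /negP nSi; apply: ntH.
  rewrite defH para_trivial ?conj_trivial // => k; apply/negP => Sk.
  by rewrite -(HS _ Sk) Sk in nSi.
move=> [g [i Hi]]; suff [S [u [v [k Sk [eS eSI]]]]] :
    exists S u v, exists2 k, S k & H = conj_set g (para S) /\
      S =1 predI (star u) (star v).
  rewrite eS; split; first exact/conj_nontrivial/(para_nontrivial Sk).
  exists (conj_set g (para (star u))), (conj_set g (para (star v))).
  by rewrite -conj_setI paraIE (eq_para G eSI); split=> //; apply/max_productsP;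
    [exists g, u|exists g, v].
case: Hi => ->; [exists (star i), i, i|exists (edge i), i, (i + 1)%R|
  exists (pred1 i), (i - 1)%R, (i + 1)%R]; exists i => //; try split=> // j.
- exact: star_refl.
- by rewrite /= andbb.
- by apply/edgeP; left.
- apply/idP/andP => [ij|[]]; last exact: star_starS.
  by split; [apply: edge_star|apply: edge_starS].
- exact: eqxx.
move: (i - 1)%R (subrK 1%R i) => k <- /=; apply/eqP/andP => [->|[]]; last exact: star_starSS.
by rewrite /star /adjz !eqxx !orbT.
Qed.

Lemma star_not_edge i j : ~ (forall k : 'Z_n, star i k -> edge j k).
Proof.
move=> sij.
have e1 : i = j by apply: (star_inj hn) => k /sij/edge_star.
have e2 : i = (j + 1)%R by apply: (star_inj hn) => k /sij/edge_starS.
by have := adjz_irr hn j; rewrite /adjz -e2 e1 eqxx.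
Qed.

Lemma edge_not_vertex i j : ~ (forall k, edge i k -> k = j).
Proof.
move=> sij; have := adjz_irr hn i; rewrite /adjz.
have e1 := sij i ((edgeP i i).2 (or_introl erefl)).
have e2 := sij (i + 1)%R ((edgeP i _).2 (or_intror erefl)).
by rewrite e2 -e1 eqxx.
Qed.

Lemma star_C_maximal g i : C_maximal (conj_set g (para (star i)) : set C).
Proof.
split; first by apply/coll_CP; exists g, i; constructor 1.
move=> K /coll_CP[h [j [->|->|->]]] /conj_subE.
- move=> /(sub_star_conj hn ntG)[<- igh].
  by rewrite -(mulVKg g h) conj_setM conj_para.
- by move=> /(sub_conj_para ntG)[/star_not_edge].
- move=> /(sub_conj_para ntG)[sij _]; case: (@star_not_edge i j) => k /sij /eqP->.
  by apply/edgeP; left.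
Qed.

Lemma vertex_C_minimal g i : C_minimal (conj_set g (para (pred1 i)) : set C).
Proof.
split; first by apply/coll_CP; exists g, i; constructor 3.
move=> K /coll_CP[h [j [->|->|->]]] /conj_subE.
- move=> /(sub_conj_para ntG)[sji _]; case: (@star_not_edge j i) => k /sji /eqP->.
  by apply/edgeP; left.
- by move=> /(sub_conj_para ntG)[sji _]; case: (@edge_not_vertex j i) => k /sji /eqP.
move=> sub; have [x ntx] := ntG j.
have jx : para (pred1 j) (cyc_in x) by apply: para_in; apply: eqxx.
have ntx' : cyc_in x <> 1 by rewrite -(cyc_in1 G j) => /cyc_in_inj.
have [eji jhg] := in_conj_para1 ntx' jx (sub _ jx).
by rewrite -(mulVKg h g) conj_setM -eji (conj_star_para1 jhg).
Qed.

Lemma C_mediumP H : C_medium H <-> exists g i, H = conj_set g (para (edge i)).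
Proof.
split=> [[/coll_CP[g [i [->|->|->]]] nmin nmax]|[g [i ->]]].
- by case: nmax; apply: star_C_maximal.
- by exists g, i.
- by case: nmin; apply: vertex_C_minimal.
split=> [|[_ min]|[_ max]]; first by apply/coll_CP; exists g, i; constructor 2.
  have /conj_set_inj e : conj_set g (para (pred1 i)) = conj_set g (para (edge i)).
    apply: min; first by apply/coll_CP; exists g, i; constructor 3.
    by apply/conj_setS/sub_para => k /eqP->; apply/edgeP; left.
  case: (@edge_not_vertex i i) => k ik; apply/eqP.
  by move: k ik; apply: sub_paraE; rewrite e.
have /conj_set_inj e : conj_set g (para (star i)) = conj_set g (para (edge i)).
  apply: max; first by apply/coll_CP; exists g, i; constructor 1.
  by apply/conj_setS/sub_para => k; apply: edge_star.
by case: (@star_not_edge i i); apply: sub_paraE; rewrite e.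
Qed.

Lemma C_maximalP H : C_maximal H <-> exists g i, H = conj_set g (para (star i)).
Proof.
split=> [[/coll_CP[g [i [->|->|->]]] max]|[g [i ->]]]; last exact: star_C_maximal.
- by exists g, i.
- exists g, i; apply/esym/max; first by apply/coll_CP; exists g, i; constructor 1.
  by apply/conj_setS/sub_para => k; apply: edge_star.
exists g, i; apply/esym/max; first by apply/coll_CP; exists g, i; constructor 1.
by apply/conj_setS/sub_para => k /eqP->; apply: star_refl.
Qed.

End Collection.

(** * Adjacency *)

Section PingPong.
Variables (n : nat) (hn : (5 <= n)%N) (G : 'Z_n -> groupType).
Local Notation C := (cyclic_product G).
Local Notation word := (seq (letter G)).
Variables (i : 'Z_n) (w : word).
Local Notation m := (i + 1)%R.
Local Notation k := (i + 1 + 1)%R.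

Definition tags (u : word) : seq 'Z_n := map (fun l => tag l) u.
Local Notation neq := (fun a b : 'Z_n => a != b).

Lemma reduced_alternate (u : word) : reduced u -> sorted neq (tags u).
Proof.
elim: u => [//|l [//|l' u] IHu] red.
have := IHu (reduced_catr (u := [:: l]) red); rewrite /= => ->; rewrite andbT.
apply/negP => /eqP e; by have := red.2 [::] l [::] l' u erefl e.
Qed.

Lemma alternate_reduced (u : word) : letters_in (pred2 i k) u ->
  (forall u1 l u2, u = u1 ++ l :: u2 -> tagged l <> 1) ->
  sorted neq (tags u) -> reduced u.
Proof.
move=> iku nt alt; split=> // u1 l u2 l' u3 def_u tl.
have nik : star i k = false /\ star k i = false.
  have := (succ_ZnP hn m i).1 erefl; have := (succ_ZnP hn k m).1 erefl.
  rewrite [star k i]starC; split; apply/negP; rewrite starP adjzP // eqZnP;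
  have := ltZn hn i; lia.
move: iku alt; rewrite def_u /tags map_cat /= letters_in_cat /=.
case: u2 {def_u} => [|l2 u2] /= /andP[_ /andP[il il2]].
  by move=> /cat_sorted2[_] /=; rewrite tl eqxx.
move: il2 => /andP[il2 _] /cat_sorted2[_] /= /andP[ne _].
by case/orP: il il2 ne => /eqP -> /orP[]/eqP ->; rewrite ?eqxx // ?nik.1 ?nik.2.
Qed.

(* For w alternating between G_k and G_i, these are the alternating products *)
(* of elements of G_i and of [w] G_k [w]^-1; they are reduced as written.    *)
Inductive ping_pong : bool -> word -> Prop :=
| pp_nil b : ping_pong b [::]
| pp_in (x : G i) u : x <> 1 -> ping_pong true u -> ping_pong false (mk_letter x :: u)
| pp_out (y : G k) u : y <> 1 -> ping_pong false u ->
    ping_pong true (w ++ mk_letter y :: inv_word w ++ u).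

Hypothesis red_w : reduced w.
Hypothesis w_in : letters_in (pred2 i k) w.
Variable t : seq 'Z_n.
Hypothesis tags_w : tags w = k :: t.
Hypothesis w_last : last k t = i.

Lemma tags_inv (u : word) : tags (inv_word u) = rev (tags u).
Proof. by rewrite /tags /inv_word map_rev -map_comp. Qed.

(** As [w] starts in G_k and ends in G_i, it can be followed by a letter of G_k, then by its
    inverse, then by a word starting in G_i, with tags still alternating. *)
Lemma ping_pong_path b u : ping_pong b u -> path neq (if b then i else k) (tags u).
Proof.
elim=> {b u} [//|x u ntx _ /= ->|y u nty _ IHu]; first by rewrite (succ2_neq hn).
have alt_w : path neq k t by have := reduced_alternate red_w; rewrite tags_w.
rewrite /tags !map_cat /= map_cat -!/(tags _) tags_inv tags_w /= eq_sym (succ2_neq hn) /=.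
rewrite cat_path alt_w /= w_last eq_sym (succ2_neq hn) cat_path /= rev_cons last_rcons IHu andbT.
rewrite -rev_cons -[path _ _ _]/(sorted neq (k :: rev (k :: t))) -rev_rcons rev_sorted /=.
rewrite rcons_path w_last (succ2_neq hn) andbT; rewrite (eq_path (e' := neq)) //.
by move=> x z; rewrite eq_sym.
Qed.

Definition nontrivial_letters (u : word) :=
  forall u1 l u2, u = u1 ++ l :: u2 -> tagged l <> 1.

Lemma nontrivial_letters_cat u v :
  nontrivial_letters u -> nontrivial_letters v -> nontrivial_letters (u ++ v).
Proof.
move=> ntu ntv u1 l u2 e; case: (cat_cons_split e) => [[c def_u _]|[c def_v _]].
  exact: ntu def_u.
exact: ntv def_v.
Qed.

Lemma nontrivial_letters_inv u : nontrivial_letters u -> nontrivial_letters (inv_word u).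
Proof.
move=> ntu u1 l u2 def_u l1.
have := ntu (inv_word u2) (inv_letter l) (inv_word u1).
case; last by rewrite /inv_letter /= l1 invg1.
by rewrite -(inv_wordK u) def_u -cat1s !inv_word_cat -catA.
Qed.

Lemma nontrivial_letter1 (j : 'Z_n) (x : G j) : x <> 1 -> nontrivial_letters [:: mk_letter x].
Proof. by move=> /reduced_letter[]. Qed.

Lemma ping_pong_reduced b u : ping_pong b u -> reduced u.
Proof.
move=> ppu; apply: alternate_reduced; last exact: path_sorted (ping_pong_path ppu).
  elim: ppu => {b u} [//|x u _ _ /= ->|y u _ _ IHu]; first by rewrite eqxx.
  by rewrite !letters_in_cat /= letters_in_cat letters_in_inv IHu w_in eqxx orbT.
elim: ppu => {b u} [_ [|l u1] //|x u ntx _ IHu|y u nty _ IHu].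
  rewrite -cat1s; apply: nontrivial_letters_cat IHu; exact: nontrivial_letter1.
apply: (nontrivial_letters_cat red_w.1); rewrite -cat1s.
apply: nontrivial_letters_cat; first exact: nontrivial_letter1.
by apply: nontrivial_letters_cat IHu; apply/nontrivial_letters_inv/red_w.1.
Qed.

(** The factor [z] absorbs G_(i+1), which commutes with G_i and G_(i+2), hence with [w]. *)
Definition ping_pong_set : set C := [set g | exists z : G m, exists b u,
  ping_pong b u /\ g = cyc_in z * cyc_class u].

Lemma ping_pong_inl b u (x : G i) : ping_pong b u -> exists b' u',
  ping_pong b' u' /\ cyc_in x * cyc_class u = cyc_class u'.
Proof.
have [->|/eqP ntx] := eqVneq x 1; first by exists b, u; rewrite cyc_in1 mul1g.
have key v : ping_pong true v -> exists b' u',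
    ping_pong b' u' /\ cyc_in x * cyc_class v = cyc_class u'.
  move=> ppv; exists false, (mk_letter x :: v); split; first exact: pp_in.
  by rewrite (cyc_class_cons (mk_letter x)) cyc_in_letter.
case=> [b'|y v nty ppv|y v nty ppv]; [exact/key/pp_nil| |exact/key/pp_out].
rewrite cyc_class_cons cyc_in_letter mulgA -cyc_inM.
have [->|/eqP ntxy] := eqVneq (x * y) 1.
  by exists true, v; rewrite cyc_in1 mul1g.
exists false, (mk_letter (x * y) :: v); split; first exact: pp_in.
by rewrite (cyc_class_cons (mk_letter _)) cyc_in_letter.
Qed.

Lemma ping_pong_outl b u (x : G k) : ping_pong b u -> exists b' u', ping_pong b' u' /\
  cyc_class w * cyc_in x * (cyc_class w)^-1 * cyc_class u = cyc_class u'.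
Proof.
have [->|/eqP ntx] := eqVneq x 1; first by exists b, u; rewrite cyc_in1 mulg1 mulgV mul1g.
have outE (y : G k) v : cyc_class (w ++ mk_letter y :: inv_word w ++ v) =
    cyc_class w * cyc_in y * (cyc_class w)^-1 * cyc_class v.
  by rewrite cyc_class_cat (cyc_class_cons (mk_letter y)) cyc_in_letter cyc_class_cat
    cyc_class_inv !mulgA.
have key v : ping_pong false v -> exists b' u', ping_pong b' u' /\
    cyc_class w * cyc_in x * (cyc_class w)^-1 * cyc_class v = cyc_class u'.
  by move=> ppv; exists true, (w ++ mk_letter x :: inv_word w ++ v); split;
    [exact: pp_out|rewrite outE].
case=> [b'|y v nty ppv|y v nty ppv]; [exact/key/pp_nil|exact/key/pp_in|].
have -> : cyc_class w * cyc_in x * (cyc_class w)^-1 *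
    cyc_class (w ++ mk_letter y :: inv_word w ++ v) =
    cyc_class w * cyc_in (x * y) * (cyc_class w)^-1 * cyc_class v.
  by rewrite outE cyc_inM !mulgA mulgVK.
have [->|/eqP ntxy] := eqVneq (x * y) 1.
  by exists false, v; rewrite cyc_in1 mulg1 mulgV mul1g.
exists true, (w ++ mk_letter (x * y) :: inv_word w ++ v).
by split; [exact: pp_out|rewrite outE].
Qed.

Lemma edge_mul (j : 'Z_n) g : para (edge j) g ->
  exists (x : G j) (y : G (j + 1)%R), g = cyc_in x * cyc_in y.
Proof.
pose N : set C := [set g | exists (x : G j) (y : G (j + 1)%R), g = cyc_in x * cyc_in y].
suff : para (edge j) `<=` N by apply.
apply: para_min => [|l x /edgeP ej].
  split=> [|_ _ [x [y ->]] [x' [y' ->]]]; first by exists 1, 1; rewrite !cyc_in1 mulg1.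
  exists (x / x'), (y / y').
  have c : cyc_in x'^-1 * cyc_in (y / y') = cyc_in (y / y') * cyc_in x'^-1.
    by apply: cyc_in_commute; rewrite /adjz eqxx.
  by rewrite [in RHS]cyc_inM -[in RHS]mulgA c invgM !cyc_inM !cyc_inV !mulgA.
case: ej => e; subst; first by exists x, 1; rewrite cyc_in1 mulg1.
by exists 1, x; rewrite cyc_in1 mul1g.
Qed.

Lemma ping_pong_tag b u : ping_pong b u -> letters_in (fun j => j != i) u -> u = [::].
Proof.
case=> [//|x v _ _ /=|y v _ _]; first by rewrite eqxx.
rewrite letters_in_cat => /andP[+ _].
move=> ov; have /allP/(_ i) : all (fun j => j != i) (tags w) by rewrite all_map.
by have := mem_last k t; rewrite w_last tags_w eqxx => -> /(_ isT).
Qed.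

(** The elements whose left multiplication preserves [ping_pong_set] form a subgroup [N]. It
    contains both generating subgroups, by [ping_pong_inl] and [ping_pong_outl]; applying it to 1
    gives the inclusion. *)
Lemma join_ping_pong_set : join_subgroup (para (edge i)) (conj_set (cyc_class w) (para (edge m)))
  `<=` ping_pong_set.
Proof.
pose N : set C := [set q | forall g, ping_pong_set (q * g) <-> ping_pong_set g].
have sgN : is_subgroup N.
  split=> [g|p q Np Nq g]; first by rewrite mul1g.
  by rewrite -mulgA; split=> [/Np|?]; rewrite -?(Nq (q^-1 * g)) ?mulVKg //;
    apply/Np; rewrite -(Nq (q^-1 * g)) mulVKg.
have half (S : set C) : is_subgroup S -> (forall q g, S q -> ping_pong_set g -> ping_pong_set (q * g)) ->
    S `<=` N.
  move=> sgS SP q Sq g; split; last exact: SP.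
  move=> /(SP q^-1); rewrite mulKg; apply.
  by rewrite -div1g; apply: sgS.2 => //; apply: sgS.1.
suff sub : join_subgroup (para (edge i)) (conj_set (cyc_class w) (para (edge m))) `<=` N.
  move=> g /sub/(_ 1); rewrite mulg1 => ->; exists 1, true, [::].
  by rewrite cyc_in1 mulg1; split; first exact: pp_nil.
apply: join_sub => //; apply: half.
- exact: para_subgroup.
- move=> q g /edge_mul[x [y ->]] [z [b [u [ppu ->]]]].
  have [b' [u' [ppu' def_u']]] := ping_pong_inl x ppu.
  exists (y * z), b', u'; split=> //; rewrite -def_u' -mulgA (mulgA (cyc_in y)) -cyc_inM.
  by rewrite !mulgA (@cyc_in_commute _ G i m x) // /adjz eqxx.
- exact/conj_is_subgroup/para_subgroup.
- move=> q g; rewrite conj_setE => /edge_mul[y [x e]] [z [b [u [ppu ->]]]].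
  have [b' [u' [ppu' def_u']]] := ping_pong_outl x ppu.
  have wm (y' : G m) : cyc_in y' * cyc_class w = cyc_class w * cyc_in y'.
    apply: link_commute; apply: para_in; apply: sub_letters_in w_in => j.
    by case/orP=> /eqP->; rewrite /adjz eqxx ?orbT.
  have xm (y' : G m) : cyc_in y' * cyc_in x = cyc_in x * cyc_in y'.
    by apply: cyc_in_commute; rewrite /adjz eqxx.
  exists (y * z), b', u'; split=> //; rewrite -def_u'.
  have -> : q = cyc_in y * (cyc_class w * cyc_in x * (cyc_class w)^-1).
    by rewrite !mulgA wm -(mulgA (cyc_class w)) -e !mulgA mulgV mul1g mulgK.
  have cz : commute (cyc_in z) (cyc_class w * cyc_in x * (cyc_class w)^-1).
    by apply: commuteM; [apply: commuteM; [exact: wm|exact: xm]|apply/commuteV/wm].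
  by rewrite -[LHS]mulgA (mulgA _ (cyc_in z)) -cz cyc_inM !mulgA.
Qed.

End PingPong.

(** * Generating a star subgroup by two edge subgroups *)

Section Adjacency.
Variables (n : nat) (hn : (5 <= n)%N) (G : 'Z_n -> groupType).
Hypothesis ntG : forall i : 'Z_n, exists x : G i, x <> 1.
Local Notation C := (cyclic_product G).
Implicit Types (i j k u v : 'Z_n) (g h x : C) (H K L : set C).

Lemma star_succP i j : star (i + 1)%R j -> [\/ j = i, j = (i + 1)%R | j = (i + 1 + 1)%R].
Proof.
have := (succ_ZnP hn _ _).1 (erefl (i + 1)%R).
have := (succ_ZnP hn _ _).1 (erefl (i + 1 + 1)%R); rewrite !starP !adjzP // !eqZnP => e1 e2 e3.
have : j = i \/ j = (i + 1)%R \/ j = (i + 1 + 1)%R.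
  rewrite !eqZnP; have := ltZn hn i; have := ltZn hn j.
  have := ltZn hn (i + 1)%R; have := ltZn hn (i + 1 + 1)%R; lia.
by case=> [|[]] ?; [constructor 1|constructor 2|constructor 3].
Qed.

(** If the middle word [w] of the double coset of [x] is nonempty, it alternates between G_(m+1) and
    G_i, starting in the former and ending in the latter. Ping-pong then shows that a nontrivial
    element of G_(m+1) is not generated. *)
Lemma generate_star i x (m := (i + 1)%R) : para (star m) x ->
  para (star m) `<=` join_subgroup (para (edge i)) (conj_set x (para (edge m))) ->
  exists p q, [/\ para (edge i) p, para (edge m) q & x = p * q].
Proof.
move=> mx gen; have [s [w [t [is_ mt def_x [redw lw rw]]]]] := double_coset (edge i) (edge m) x.
have ms : para (star m) s by apply: sub_para is_ => j; apply: edge_starS.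
have mt' : para (star m) t by apply: sub_para mt => j; apply: edge_star.
have mw : letters_in (star m) w.
  by apply: reduced_para redw _; move: mx; rewrite def_x paraMr // paraMl.
have w_in : letters_in (pred2 i (m + 1)%R) w.
  apply: letters_in_split => w1 l w2 def_w /=.
  move: mw; rewrite def_w letters_in_cat /= => /and3P[m1 ml _].
  case: (star_succP ml) => [->|el|->]; rewrite ?eqxx ?orbT //.
  (* G_m commutes with the other factors of its star, so an m-letter could be moved to the left
     end. *)
  have il : edge i (tag l) by rewrite el; apply/edgeP; right.
  by have /negP[] := lw _ _ _ def_w il; rewrite el.
have [w0|w_nil] := pselect (w = [::]).
  by exists s, t; split=> //; rewrite def_x w0 cyc_class_nil mulg1.
have [r tags_w] : exists r, tags w = (m + 1)%R :: r.
  case: (w) w_nil w_in lw => [//|l w'] _ /andP[/orP[]/eqP el _] lw; last first.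
    by exists (tags w'); rewrite /= el.
  have il : edge i (tag l) by rewrite el; apply/edgeP; left.
  by have := lw [::] l w' erefl il.
have w_last : last (m + 1)%R r = i.
  have -> : last (m + 1)%R r = last i (tags w) by rewrite tags_w.
  case/lastP: (w) w_nil w_in rw => [//|w' l] _.
  rewrite -cats1 letters_in_cat /= andbT => /andP[_ /orP[]/eqP el] rw.
    by rewrite /tags map_cat /= last_cat.
  have ml : edge m (tag l) by rewrite el; apply/edgeP; right.
  by have := rw w' l [::]; rewrite cats1 => /(_ erefl ml).
have [y nty] := ntG (m + 1)%R.
have : (@ping_pong_set n G i w) (cyc_in y).
  have sub := join_ping_pong_set w_in; apply: sub.
  (* Conjugation by [s^-1] preserves the first edge subgroup and replaces [x] by [w], since [t]
     normalises the second. *)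
  have -> : para (edge i) = conj_set s^-1 (para (edge i)) by rewrite conj_para //; apply: paraV.
  have -> : conj_set (cyc_class w) (para (edge m)) = conj_set s^-1 (conj_set x (para (edge m))).
    by rewrite def_x -!conj_setM -mulgA mulKg conj_setM (conj_para mt).
  rewrite -conj_join conj_setE invgK; apply: gen; rewrite paraMr; last exact: paraV.
  by rewrite paraMl //; apply: para_in; rewrite /star /adjz eqxx !orbT.
move=> [z [b [u [ppu def_y]]]].
have u0 : u = [::].
  apply: (ping_pong_tag tags_w w_last ppu).
  apply: reduced_para; first exact: (ping_pong_reduced hn redw w_in tags_w w_last ppu).
  have -> : cyc_class u = cyc_in z^-1 * cyc_in y by rewrite def_y cyc_inV mulKg.
  by apply: paraM; apply: para_in; [exact: succ_neq|exact: succ2_neq].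
have : para (pred1 m) (cyc_in y).
  by rewrite def_y u0 cyc_class_nil mulg1; apply: para_in; apply: eqxx.
by move=> /(para_inE nty)/= /eqP e; have := succ_neq m; rewrite e eqxx.
Qed.

Lemma X_mk_eq g h i j : X_mk (G := G) g i = X_mk h j <-> i = j /\ para (edge i) (g^-1 * h).
Proof.
split=> [/(congr1 val)|[<- igh]]; last first.
  apply: val_inj; rewrite /= vertex_groupE -(mulVKg g h) lcosetM; congr lcoset.
  apply/seteqP; split=> [x ix|_ [x ix <-]]; last exact: paraM.
  by exists ((g^-1 * h)^-1 * x); rewrite ?mulVKg //; apply: paraM ix; apply: paraV.
rewrite /= !vertex_groupE => e.
have jhg : para (edge j) (h^-1 * g).
  have : lcoset g (para (edge i)) g by exists 1; rewrite ?mulg1 //; apply: para1.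
  by rewrite e => -[x jx <-]; rewrite mulKg.
have eij : para (edge i) = para (edge j) :> set C.
  rewrite -(lcoset1 (para (edge i))) -(mulVg g) lcosetM e -lcosetM.
  apply/seteqP; split=> [_ [x jx <-]|x jx].
    by apply: paraM jx; rewrite -paraVE invgM invgK.
  by exists (h^-1 * g * x); [exact: paraM|rewrite !mulgA mulgK mulVg mul1g].
have ij : i = j.
  by apply: (edge_inj hn); apply: (sub_paraE ntG (S := edge i) (T := edge j));
   rewrite ?eij //; apply/edgeP; auto.
by split=> //; rewrite eij -paraVE invgM invgK.
Qed.

(* The crossing label with Q = setT is the retraction killing every G_j, j <> v. *)
Definition retraction v g : G v := cross v setT 1 (cyc_word g).

Lemma crossT v g (w : seq (letter G)) : cross v setT g w = cross v setT 1 w.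
Proof.
by elim: w g => [//|l w IHw] g /=; rewrite !(asboolT I) IHw [in RHS]IHw.
Qed.

Lemma retraction_class v w : retraction v (cyc_class w) = cross v setT 1 w.
Proof. by apply: cross_class => [g j x _|]; [|exact: cyc_wordK]. Qed.

Lemma retractionM v : {morph retraction v : g h / g * h}.
Proof.
move=> g h; rewrite -(cyc_wordK g) -(cyc_wordK h) -cyc_class_cat !retraction_class.
by rewrite cross_cat (crossT v (_ * _)).
Qed.

Lemma retraction1 v : retraction v 1 = 1.
Proof. by rewrite -cyc_class_nil retraction_class. Qed.

Lemma retraction_in v (x : G v) : retraction v (cyc_in x) = x.
Proof. by rewrite retraction_class /= (asboolT I) mulg1 letter_atE. Qed.

Lemma retraction_kill v S g : ~~ S v -> para S g -> retraction v g = 1.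
Proof.
move=> nSv [w Sw <-]; rewrite retraction_class; apply: cross_free => w1 l w2 def_w tl.
by move: Sw nSv; rewrite def_w letters_in_cat /= tl => /and3P[_ ->].
Qed.

Lemma retractionV v g : retraction v g^-1 = (retraction v g)^-1.
Proof. by apply/esym/mulg1_eq; rewrite -retractionM mulgV retraction1. Qed.

Lemma retraction_join v S T g h x : ~~ S v -> ~~ T v ->
  join_subgroup (conj_set g (para S)) (conj_set h (para T)) x -> retraction v x = 1.
Proof.
move=> nS nT; pose N : set C := [set x | retraction v x = 1].
suff : join_subgroup (conj_set g (para S)) (conj_set h (para T)) `<=` N by apply.
apply: join_sub.
- split=> [|a b]; first exact: retraction1.
  by rewrite /N /= retractionM retractionV => -> ->; rewrite invg1 mulg1.
- move=> _ [a Sa <-]; rewrite /N /= !retractionM retractionV (retraction_kill nS Sa).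
  by rewrite mulg1 mulgV.
- move=> _ [a Ta <-]; rewrite /N /= !retractionM retractionV (retraction_kill nT Ta).
  by rewrite mulg1 mulgV.
Qed.

Lemma join_edges i : join_subgroup (para (edge i)) (para (edge (i + 1)%R)) =
  para (star (i + 1)%R) :> set C.
Proof.
apply/seteqP; split.
  by apply: join_sub; [exact: para_subgroup| |]; apply: sub_para => j;
    [apply: edge_starS|apply: edge_star].
apply: para_min => [|j x]; first exact: join_is_subgroup.
case/star_succP => e; [apply: join_subl|apply: join_subl|apply: join_subr];
  by apply: para_in; apply/edgeP; auto.
Qed.

Lemma sub_star_edge i m : star m i -> star m (i + 1)%R -> i = m \/ (i + 1)%R = m.
Proof.
have := (succ_ZnP hn _ _).1 (erefl (i + 1)%R); rewrite !starP !adjzP // !eqZnP.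
have := ltZn hn i; have := ltZn hn m; lia.
Qed.

Lemma conj_star_edge g h i v : conj_set g (para (edge i)) `<=` conj_set h (para (star v)) ->
  [/\ i = v \/ (i + 1)%R = v & exists g', para (edge i) (g^-1 * g') /\ para (star v) (g'^-1 * h)].
Proof.
move=> /conj_subE/(sub_edge_conj hn ntG)[vi vSi [s [t [is_ vt def_gh]]]].
split; first exact: sub_star_edge.
exists (g * s); rewrite mulKg; split=> //.
by rewrite invgM -mulgA def_gh mulKg.
Qed.

Lemma generate_adj g h i (m := (i + 1)%R) : para (star m) (g^-1 * h) ->
  join_subgroup (conj_set g (para (edge i))) (conj_set h (para (edge m))) =
    conj_set g (para (star m)) ->
  X_adj (X_mk (G := G) g i) (X_mk h m).
Proof.
move=> mgh def_J; have [|p [q [ip mq def_gh]]] := @generate_star i (g^-1 * h) mgh.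
  apply/(conj_setSE g); rewrite conj_join -conj_setM mulVKg -def_J; exact: subset_refl.
exists (g * p), m; left; rewrite addrK; split; apply/X_mk_eq; split=> //.
  by rewrite mulKg.
have -> : h = g * p * q by rewrite -mulgA -def_gh mulVKg.
by rewrite invgM mulgVK; apply: paraV.
Qed.

(** Both edge subgroups lie in one star conjugate, so i and j are m - 1 or m. If i = j, a retraction
    detects a factor of the star that is missed; otherwise [generate_adj] applies. *)
Lemma C_maximal_adj g h i j :
  C_maximal (join_subgroup (conj_set g (para (edge i))) (conj_set h (para (edge j)))) <->
  X_adj (X_mk (G := G) g i) (X_mk h j).
Proof.
have adj_max g' l : C_maximal (join_subgroup (conj_set g' (para (edge (l - 1)%R)))
    (conj_set g' (para (edge l)))).
  rewrite -conj_join -{2}(subrK 1%R l) join_edges; apply/C_maximalP => //.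
  by exists g', (l - 1 + 1)%R.
have conjE a b u v : X_mk (G := G) a u = X_mk b v ->
    conj_set a (para (edge u)) = conj_set b (para (edge v)).
  by move=> /X_mk_eq[<- iab]; rewrite -(mulVKg a b) conj_setM (conj_para iab).
split; last first.
  move=> [k [l [[e1 e2]|[e1 e2]]]]; rewrite (conjE _ _ _ _ e1) (conjE _ _ _ _ e2) //.
  by rewrite /join_subgroup setUC; apply: adj_max.
move=> /(C_maximalP hn ntG)[k [m def_J]].
have [im [g' [igg' mg']]] : [/\ i = m \/ (i + 1)%R = m & exists g', para (edge i) (g^-1 * g') /\
    para (star m) (g'^-1 * k)].
  by apply: conj_star_edge; rewrite -def_J; apply: join_subl.
have [jm [h' [jhh' mh']]] : [/\ j = m \/ (j + 1)%R = m & exists h', para (edge j) (h^-1 * h') /\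
    para (star m) (h'^-1 * k)].
  by apply: conj_star_edge; rewrite -def_J; apply: join_subr.
have eg : X_mk (G := G) g i = X_mk g' i by apply/X_mk_eq.
have eh : X_mk (G := G) h j = X_mk h' j by apply/X_mk_eq.
rewrite eg eh (conjE _ _ _ _ eg) (conjE _ _ _ _ eh) in def_J *.
have kE f : para (star m) (f^-1 * k) -> conj_set k (para (star m)) = conj_set f (para (star m)).
  by move=> mf; rewrite -(mulVKg f k) conj_setM (conj_para mf).
have mgh : para (star m) (g'^-1 * h').
  have -> : g'^-1 * h' = (g'^-1 * k) * (h'^-1 * k)^-1 by rewrite invgM invgK !mulgA mulgK.
  by apply: paraM => //; apply: paraV.
(* The retraction onto G_v kills both edge conjugates but not the star conjugate that they
   generate. *)
have excl v : star m v -> ~~ edge i v -> ~~ edge j v -> False.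
  move=> mv niv njv; have [y nty] := ntG v; apply: nty.
  have : conj_set k (para (star m)) (k * cyc_in y / k).
    by exists (cyc_in y) => //; apply: para_in.
  rewrite -def_J => /(retraction_join niv njv); rewrite !retractionM retractionV retraction_in.
  move=> e; apply: (@mulgI _ (retraction v k)); apply: (@mulIg _ (retraction v k)^-1).
  by rewrite e mulg1 mulgV.
have Em : ((m - 1) + 1)%R = m by rewrite subrK.
case: im jm => im [] jm.
- have nm : ~~ edge m (m - 1)%R.
    rewrite -{1}Em /edge /= negb_or eq_sym succ_neq eq_sym; exact: succ2_neq.
  by case: (@excl (m - 1)%R); rewrite ?im ?jm // /star /adjz Em eqxx !orbT.
- subst i; subst m; apply: X_adj_sym; apply: generate_adj.
    by rewrite -paraVE invgM invgK.
  by rewrite /join_subgroup setUC -(kE _ mh').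
- subst j; subst m; apply: generate_adj => //.
  by rewrite -(kE _ mg').
- have e : i = j by apply: (addIr 1%R); rewrite im.
  subst j; subst m; have ni : ~~ edge i (i + 1 + 1)%R.
    by rewrite /edge /= negb_or succ_neq succ2_neq.
  by case: (@excl (i + 1 + 1)%R); rewrite // /star /adjz eqxx !orbT.
Qed.

End Adjacency.

(** * Polygons *)

Section Returns.
Variables (n : nat) (G : 'Z_n -> groupType) (v : 'Z_n).
Local Notation C := (cyclic_product G).

(** For star-stable [Q] any word for [g] gives this value, so along a path the sector changes
    exactly by the letters that cross [Q]. *)
Definition sector (Q : set C) (g : C) : G v := cross v Q 1 (cyc_word g).

Lemma sectorM Q g l : star_stable v Q ->
  sector Q (g * cyc_class [:: l]) = sector Q g * (if `[< Q g >] then letter_at v l else 1).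
Proof.
move=> sQ; rewrite /sector (@cross_class _ _ _ _ _ _ (cyc_word g ++ [:: l]) sQ).
  by rewrite cross_cat /= mul1g mulg1 cyc_wordK.
by rewrite cyc_wordK cyc_class_cat cyc_wordK.
Qed.

Lemma sector_star Q g r : star_stable v Q -> ~ Q g -> para (star v) r ->
  sector Q (g * r) = sector Q g.
Proof.
move=> sQ nQ [w vw <-]; elim: w g nQ vw => [|l w IHw] g nQ; first by rewrite cyc_class_nil mulg1.
move=> /andP[vl vw]; rewrite cyc_class_cons mulgA IHw //; first by rewrite sectorM // asboolF ?mulg1.
by rewrite cyc_in_letter sQ.
Qed.

Variables (L : nat -> letter G) (F : nat -> C).
Hypothesis FS : forall k, F k.+1 = F k * cyc_class [:: L k].

Definition crosses Q k := tag (L k) = v /\ Q (F k).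

Lemma sector_path Q a b : star_stable v Q -> (a <= b)%N ->
  (forall k, (a <= k < b)%N -> ~ crosses Q k) -> sector Q (F b) = sector Q (F a).
Proof.
move=> sQ; elim: b => [|b IHb]; first by rewrite leqn0 => /eqP->.
rewrite leq_eqVlt => /predU1P[<-//|ab] nQ.
rewrite FS sectorM // IHb //; last by move=> k lek; apply: nQ; lia.
have [e|ne] := eqVneq (tag (L b)) v; last by rewrite letter_at_neq // if_same mulg1.
by rewrite asboolF ?mulg1 // => Q'; apply: (nQ b); [lia|].
Qed.

Lemma wall_sym (g h : C) : wall v g h -> wall v h g.
Proof. by rewrite /wall /= -paraVE invgM invgK. Qed.

Variable N : nat.
Hypothesis ntL : forall k, (k < N)%N -> tag (L k) = v -> tagged (L k) <> 1.

(** A single crossing would multiply the sector by the nontrivial letter [L k], while the sectors at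
    both ends agree. *)
Lemma crosses_twice a b k : (a <= k < b)%N -> (b <= N)%N -> tag (L k) = v ->
  sector (wall v (F k)) (F a) = sector (wall v (F k)) (F b) ->
  exists j, [/\ (a <= j < b)%N, j <> k & crosses (wall v (F k)) j].
Proof.
move=> akb bN tk; apply: contraPP => nj.
have sQ := @wall_stable n G v (F k).
have one j : (a <= j < b)%N -> crosses (wall v (F k)) j -> j = k.
  by move=> ajb cj; apply: contrapT => jk; apply: nj; exists j.
have eb : sector (wall v (F k)) (F b) = sector (wall v (F k)) (F k.+1).
  apply: sector_path => //; first by case/andP: akb.
  move=> j jb; have jb' : (a <= j < b)%N by lia.
  by move=> /(one _ jb') e; lia.
have ea : sector (wall v (F k)) (F k) = sector (wall v (F k)) (F a).
  apply: sector_path => //; first by case/andP: akb.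
  move=> j jb; have jb' : (a <= j < b)%N by lia.
  by move=> /(one _ jb') e; lia.
rewrite eb -ea FS sectorM // asboolT; last exact: wall_id.
rewrite -{1}[sector _ (F k)]mulg1 => /mulgI e; case: (ntL (k := k)) => //; first by lia.
by rewrite -letter_at_tag tk -e.
Qed.

(* A v-letter between a and b crosses either the wall crossed at a and b or   *)
(* one that both of these miss, which is then crossed back between a and b.  *)
Lemma innermost_return a b : (a < b < N)%N -> tag (L a) = v -> tag (L b) = v ->
  wall v (F a) (F b) -> exists k k', [/\ (k < k' < N)%N, tag (L k) = v, tag (L k') = v,
    wall v (F k) (F k') & forall j, (k < j < k')%N -> tag (L j) <> v].
Proof.
have [D] := ubnP (b - a); elim: D a b => // D IHD a b ltD ab ta tb wab.
have [[j [ajb tj]]|nj] := pselect (exists j, (a < j < b)%N /\ tag (L j) = v); last first.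
  by exists a, b; split=> // j ajb tj; apply: nj; exists j.
have [waj|nwaj] := pselect (wall v (F a) (F j)); first by apply: (IHD a j) => //; lia.
have [||//||i [aib ij [ti wij]]] := @crosses_twice a b j; [lia|lia| |].
  rewrite -(mulVKg (F a) (F b)) sector_star //; first exact: wall_stable.
  by move=> /wall_sym.
have [lt_ij|lt_ji|//] := ltngtP i j.
  apply: (IHD i j) => //; [lia| |exact: wall_sym].
  lia.
by apply: (IHD j i) => //; lia.
Qed.

Lemma closed_return k : F N = F 0 -> (k < N)%N -> tag (L k) = v ->
  exists k k', [/\ (k < k' < N)%N, tag (L k) = v, tag (L k') = v,
    wall v (F k) (F k') & forall j, (k < j < k')%N -> tag (L j) <> v].
Proof.
move=> FN kN tk; have [||//||j [jN jk [tj wj]]] := @crosses_twice 0 N k; [lia|lia| |].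
  by rewrite FN.
have [lt_jk|lt_kj|//] := ltngtP j k.
  by apply: (innermost_return (a := j) (b := k)) => //; [lia|exact: wall_sym].
by apply: (innermost_return (a := k) (b := j)) => //; lia.
Qed.
End Returns.

(** * Closed paths in X and their winding number *)

Section Cycles.
Variables (n : nat) (hn : (5 <= n)%N) (G : 'Z_n -> groupType).
Hypothesis ntG : forall i : 'Z_n, exists x : G i, x <> 1.
Local Notation C := (cyclic_product G).
Local Notation Vx := (X_vertex G).

Lemma natr_n : (n%:R = 0 :> 'Z_n)%R.
Proof. by apply: pchar_Zp; apply: leq_trans hn. Qed.

Lemma natrZ_inj (x : 'Z_n) (a b : nat) : (a <= b < a + n)%N ->
  (x + a%:R = x + b%:R)%R -> a = b.
Proof.
have n1 : (1 < n)%N by apply: leq_trans hn.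
move=> ab /addrI /(congr1 (@nat_of_ord _)); rewrite !val_Zp_nat // => /eqP.
rewrite eq_sym eqn_mod_dvd; last by case/andP: ab.
by move=> /dvdnP[[|k] e]; [lia|rewrite mulSn in e; lia].
Qed.

(** The edge from [c i] to [c (i + 1)] lies on the polygon [h i]. Consecutive polygons share
    [c (i + 1)], so they differ by one letter from each of the two factors of its edge subgroup. *)
Variables (c : 'Z_n -> Vx) (h : 'Z_n -> C) (t : 'Z_n -> 'Z_n) (l m : 'Z_n -> letter G).
Hypothesis ch : forall i, c i = X_mk (h i) (t i).
Hypothesis cSh : forall i, c (i + 1)%R = X_mk (h i) (t (i + 1)%R).
Hypothesis tl : forall i, tag (l i) = t (i + 1)%R.
Hypothesis tm : forall i, tag (m i) = (t (i + 1) + 1)%R.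
Hypothesis hS : forall i, h (i + 1)%R = h i * (cyc_class [:: l i] * cyc_class [:: m i]).

(** The only letters of type t i + 2 on the cycle are [m i] and [l (i + 1)]. As the path closes up,
    the retraction onto this factor makes their product trivial, so [h i] times [l i] is constant
    along the cycle. *)
Lemma monotone_polygon : (forall i, t (i + 1)%R = (t i + 1)%R) ->
  exists g, forall i, c i = X_mk g (t i).
Proof.
move=> up.
have t_nat i (s : nat) : t (i + s%:R)%R = (t i + s%:R)%R.
  by elim: s => [|s IHs]; rewrite ?addr0 // -natr1 !addrA up IHs.
have tl' i (s : nat) : tag (l (i + s%:R)%R) = (t i + s.+1%:R)%R.
  by rewrite tl -addrA natr1 t_nat.
have tm' i (s : nat) : tag (m (i + s%:R)%R) = (t i + s.+2%:R)%R.
  by rewrite tm -addrA natr1 t_nat -addrA natr1.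
have kill v (x : letter G) : tag x <> v -> retraction v (cyc_class [:: x]) = 1.
  move=> /eqP tx; apply: (@retraction_kill _ _ v (fun j => j != v)); rewrite ?eqxx //.
  by apply: para_word; rewrite /= tx.
have lm i : cyc_class [:: m i] * cyc_class [:: l (i + 1)%R] = 1.
  set v := (t i + 2%:R)%R.
  have neq (s : nat) : (s != 2)%N -> (s < n + 2)%N -> (t i + s%:R)%R <> v.
    case: (ltnP 2 s) => ltsn s2 sn e; first by have := natrZ_inj _ (esym e); lia.
    by have := natrZ_inj _ e; lia.
  pose r (s : nat) := retraction v (h (i + s%:R)%R).
  have rS (s : nat) : r s.+1 = r s * (retraction v (cyc_class [:: l (i + s%:R)%R]) *
      retraction v (cyc_class [:: m (i + s%:R)%R])).
    by rewrite /r -natr1 addrA hS !retractionM.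
  have r_const (s : nat) : (s.+2 <= n)%N -> r s.+2 = r 2.
    elim: s => [//|s IHs] ltsn; rewrite rS IHs; last lia.
    by rewrite !kill ?mulg1 // ?tl' ?tm'; apply: neq; lia.
  have r20 : r 2 = r 0%N.
    rewrite -(r_const (n - 2)%N); last lia.
    have -> : (n - 2).+2 = n by lia.
    by rewrite /r natr_n.
  have e1 : retraction v (cyc_class [:: m i] * cyc_class [:: l (i + 1)%R]) = 1.
    move: r20; rewrite (rS 1%N) (rS 0%N) addr0 (kill v (l i)); last first.
      by have := tl' i 0%N; rewrite addr0 => ->; apply: neq; lia.
    rewrite (kill v (m (i + 1%:R)%R)); last by rewrite tm'; apply: neq; lia.
    rewrite mul1g mulg1 -mulgA -{2}[r 0%N]mulg1 => /mulgI e; by rewrite retractionM.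
  have /para1P[x ex] : para (pred1 v) (cyc_class [:: m i] * cyc_class [:: l (i + 1)%R]).
    apply: paraM; apply: para_word; rewrite /= ?andbT.
      by have := tm' i 0%N; rewrite addr0 => ->.
    by have := tl' i 1%N => ->.
  by move: e1; rewrite ex retraction_in => ->; rewrite cyc_in1.
have g_const (s : nat) : h s%:R%R * cyc_class [:: l s%:R%R] = h 0%R * cyc_class [:: l 0%R].
  elim: s => [//|s <-]; rewrite -natr1 hS -!mulgA lm mulg1; reflexivity.
exists (h 0%R * cyc_class [:: l 0%R]) => i.
rewrite -(subrK 1%R i) cSh; apply/(X_mk_eq hn ntG); split=> //.
rewrite -(g_const (i - 1)%R) natr_Zp mulKg; apply: para_word.
by rewrite /= andbT tl; apply/edgeP; left.
Qed.

Hypothesis ht : forall i, t (i + 1)%R = (t i + 1)%R \/ t i = (t (i + 1) + 1)%R.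

(* A lift of the path t from Z/n to the integers, shifted by n to stay in nat. *)
Fixpoint height (s : nat) : nat :=
  if s is s'.+1 then
    if t s%:R%R == (t s'%:R + 1)%R then (height s').+1 else (height s').-1
  else n.

Lemma height_ge s : (n <= height s + s)%N.
Proof. by elim: s => [|s IHs] /=; [lia|case: ifP; lia]. Qed.

Lemma height_step s : (s < n)%N ->
  (height s.+1 = (height s).+1 /\ t s.+1%:R%R = (t s%:R + 1)%R) \/
  (height s = (height s.+1).+1 /\ t s%:R%R = (t s.+1%:R + 1)%R).
Proof.
move=> ltsn /=; have := height_ge s; have := ht s%:R%R; rewrite natr1.
by case: eqP => [-> _ _|ne []// -> hs]; [left|right; split=> //; lia].
Qed.

Lemma t_height s : (s <= n)%N -> t s%:R%R = (t 0 + (height s)%:R)%R.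
Proof.
elim: s => [|s IHs] ltsn; first by rewrite natr_n addr0.
have [[-> ->]|[e1 e2]] := height_step ltsn; rewrite ?IHs; try lia.
  by rewrite -addrA natr1.
by apply: (addIr 1%R); rewrite -e2 IHs ?e1 -?addrA ?natr1 //; lia.
Qed.

Lemma height_lipschitz a b : (a <= b <= n)%N ->
  (height b <= height a + (b - a))%N /\ (height a <= height b + (b - a))%N.
Proof.
elim: b => [|b IHb]; first by case: a => //=; lia.
move=> ab; have [e|ltab] : a = b.+1 \/ (a <= b)%N by lia.
  by subst; lia.
have [] := IHb; first lia.
have /height_step : (b < n)%N by lia.
by case=> [[-> _]|[-> _]]; lia.
Qed.

(** The walk closes up modulo n and has n unit steps, which leaves the winding numbers 1, -1 and
    0. *)
Lemma height_end : [\/ height n = (n + n)%N, height n = 0%N | height n = n].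
Proof.
have e : (t 0 + (height n)%:R = t 0 + 0)%R by rewrite -t_height // natr_n addr0.
have [|H _] := @height_lipschitz 0 n; first lia.
have {}H : (height n <= n + n)%N by move: H; rewrite /= subn0.
have [lt1|ge1] := ltnP (height n) n.
  by constructor 2; apply/esym/(@natrZ_inj (t 0)%R); [lia|rewrite e].
have [lt2|ge2] := ltnP (height n) (n + n).
  by constructor 3; apply/esym/(@natrZ_inj (t 0)%R); [lia|rewrite e natr_n].
by constructor 1; lia.
Qed.

Lemma rising_path : height n = (n + n)%N -> forall i, t (i + 1)%R = (t i + 1)%R.
Proof.
move=> hn2 i; rewrite -(natr_Zp i) natr1; have ltin := ltZn hn i.
have [[_ //]|[e _]] := height_step ltin.
have [] := @height_lipschitz 0 i; first lia.
have [] := @height_lipschitz i.+1 n; first lia.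
by have : height 0 = n by []; lia.
Qed.

Lemma falling_path : height n = 0%N -> forall i, t i = (t (i + 1) + 1)%R.
Proof.
move=> hn2 i; rewrite -(natr_Zp i) natr1; have ltin := ltZn hn i.
have [[e _]|[_ //]] := height_step ltin.
have [] := @height_lipschitz 0 i; first lia.
have [] := @height_lipschitz i.+1 n; first lia.
by have : height 0 = n by []; lia.
Qed.

Hypothesis inj_c : injective c.

Definition path_letter k := if odd k then m k./2%:R%R else l k./2%:R%R.
Definition path_elt k := if odd k then h k./2%:R%R * cyc_class [:: l k./2%:R%R] else h k./2%:R%R.

Lemma path_eltS k : path_elt k.+1 = path_elt k * cyc_class [:: path_letter k].
Proof.
rewrite /path_elt /path_letter /= uphalf_half; case: (odd k) => //=.
by rewrite add1n -natr1 hS mulgA.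
Qed.

Lemma tag_path_letter k : (k < n + n)%N ->
  tag (path_letter k) = (t 0 + (height (k./2).+1 + odd k)%:R)%R.
Proof.
move=> kn; have kn' : ((k./2).+1 <= n)%N by lia.
rewrite /path_letter; case: (odd k); rewrite ?tm ?tl natr1 t_height //.
  by rewrite natrD addrA.
by rewrite addn0.
Qed.

Lemma path_para (S : pred 'Z_n) a b : (a <= b)%N -> (forall k, (a <= k < b)%N -> S (tag (path_letter k))) ->
  para S ((path_elt a)^-1 * path_elt b).
Proof.
elim: b => [|b IHb].
  by rewrite leqn0 => /eqP-> _; rewrite mulVg; apply: para1.
rewrite leq_eqVlt => /predU1P[<- _|ab HS]; first by rewrite mulVg; apply: para1.
rewrite path_eltS mulgA; apply: paraM; first by apply: IHb => // k kb; apply: HS; lia.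
by apply: para_word; rewrite /= andbT; apply: HS; lia.
Qed.

(** At a highest vertex the path goes up and then down. If the letter there were trivial, the
    vertices before and after it would coincide, against injectivity of [c]. *)
Lemma turning_letter s b : (s < n)%N -> height n = n ->
  (forall s', (s' <= n)%N -> (height s' <= b)%N) -> height s.+1 = b ->
  tagged (m s%:R%R) <> 1.
Proof.
move=> ltsn hnn maxb hs m1.
have up : t (s%:R + 1)%R = (t s%:R + 1)%R.
  have := maxb s (ltnW ltsn); rewrite natr1.
  by case: (height_step ltsn) => -[e1 e2] //; lia.
have down : t (s%:R + 1)%R = (t (s%:R + 1 + 1) + 1)%R.
  (* A maximum at time n is followed by the step from time 0, where the height is also n. *)
  have [e|lt] : s.+1 = n \/ (s.+1 < n)%N by lia.
    rewrite natr1 e natr_n; have n0 : (0 < n)%N by lia.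
    have hb : b = n by rewrite -hs e hnn.
    case: (height_step n0) => -[e1 e2]; last by rewrite add0r.
    by have := maxb 1%N n0; have : height 0 = n by []; lia.
  have := maxb s.+2 lt; rewrite !natr1.
  by case: (height_step lt) => -[e1 e2] //; lia.
have tt : t (s%:R + 1 + 1)%R = t s%:R%R by apply: (addIr 1%R); rewrite -down up.
have /inj_c e : c s%:R%R = c (s%:R + 1 + 1)%R.
  rewrite ch cSh tt; apply/(X_mk_eq hn ntG); split=> //.
  rewrite hS mulKg (cyc_in_letter (m _)) m1 cyc_in1 mulg1; apply: para_word.
  by rewrite /= andbT tl up; apply/edgeP; right.
have : 0%N = 2%N by apply: (@natrZ_inj s%:R%R); [lia|rewrite addr0 {1}e -addrA].
by [].
Qed.

(* At a highest vertex the path turns back and crosses a wall of type V. The  *)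
(* indices met by the path do not wind around Z/n, so two consecutive          *)
(* crossings of the same such wall take place at the same vertex.              *)
Lemma no_reversal : height n <> n.
Proof.
move=> hnn.
(* A maximum at time 0 is moved to time n, which has the same height, so that a step precedes it. *)
have [s0 ltsn maxb] : exists2 s0, (s0 < n)%N &
    forall s, (s <= n)%N -> (height s <= height s0.+1)%N.
  have := @arg_maxnP _ (@ord0 n) xpredT (fun i => height i) isT.
  case=> -[[|s] lts] _ maxs; last first.
    by exists s => // s' les'; apply: (maxs (Ordinal (les' : s' < n.+1)%N)).
  exists n.-1; first lia.
  have -> : n.-1.+1 = n by lia.
  by move=> s' les'; rewrite hnn; apply: (maxs (Ordinal (les' : s' < n.+1)%N)).
set b := height s0.+1 in maxb.
(* A closed walk of length n falls at most n/2 below its maximum. *)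
have low s : (s <= n)%N -> (b + b <= height s + height s + n)%N.
  move=> lesn; have [les|gts] := leqP s s0.+1.
    have [] := @height_lipschitz s s0.+1; first lia.
    have [] := @height_lipschitz 0 s; first lia.
    have [] := @height_lipschitz s0.+1 n; first lia.
    have : height 0 = n by []; rewrite -/b; lia.
  have [] := @height_lipschitz s0.+1 s; first lia.
  have [] := @height_lipschitz 0 s0.+1; first lia.
  have [] := @height_lipschitz s n; first lia.
  have : height 0 = n by []; rewrite -/b; lia.
set V := (t 0 + b.+1%:R)%R.
have tagV k : (k < n + n)%N -> tag (path_letter k) = V -> odd k /\ height (k./2).+1 = b.
  move=> kn; rewrite tag_path_letter // => /natrZ_inj e.
  have kn' : ((k./2).+1 <= n)%N by lia.
  have := maxb _ kn'; have := low _ kn'; case: (odd k) e => e l1 l2.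
    have : (height (k./2).+1 + true)%N = b.+1 by apply: e; lia.
    by split=> //; lia.
  have : (height (k./2).+1 + false)%N = b.+1 by apply: e; lia.
  lia.
(* The letters have types t 0 + d with d between b - n/2 and b + 1; since n >= 5, none of these d is
   congruent to b + 2 modulo n. *)
have tagVS k : (k < n + n)%N -> tag (path_letter k) != (V + 1)%R.
  move=> kn; rewrite tag_path_letter // /V -addrA natr1; apply/eqP => /natrZ_inj e.
  have kn' : ((k./2).+1 <= n)%N by lia.
  have := maxb _ kn'; have := low _ kn'; move=> l1 l2.
  have : (height (k./2).+1 + odd k)%N = b.+2 by apply: e; lia.
  lia.
have ntL k : (k < n + n)%N -> tag (path_letter k) = V -> tagged (path_letter k) <> 1.
  move=> kn /(tagV _ kn)[ok hk]; rewrite /path_letter ok.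
  by apply: (turning_letter (b := b)) => //; lia.
have tk0 : tag (path_letter (s0.*2.+1)) = V.
  rewrite tag_path_letter; last lia.
  by rewrite /= uphalf_double odd_double addn1.
have F2n : path_elt (n + n) = path_elt 0.
  by rewrite /path_elt addnn odd_double doubleK natr_n.
have := closed_return path_eltS ntL F2n _ tk0; case; first by lia.
move=> k [k' [kk' tk tk' wkk' between]].
have [ok hk] : odd k /\ height (k./2).+1 = b by apply: tagV => //; lia.
have [ok' hk'] : odd k' /\ height (k'./2).+1 = b by apply: tagV => //; lia.
have e1 : path_elt k.+1 = h ((k./2).+1)%:R%R.
  by rewrite /path_elt /= ok uphalf_half ok add1n.
have e2 : path_elt k' = h (k'./2)%:R%R * cyc_class [:: l (k'./2)%:R%R].
  by rewrite /path_elt ok'.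
set B := (t 0 + b%:R)%R.
have BV : (B + 1)%R = V by rewrite /B /V -addrA natr1.
have tB s : (s < n)%N -> height s.+1 = b -> t (s%:R + 1)%R = B.
  by move=> sn hs; rewrite natr1 t_height // hs.
(* Between the two crossings the path stays in the star of V and avoids V and V + 1. Only B = V - 1
   is left, so both turning points are the same vertex. *)
have inB : para (edge B) ((h ((k./2).+1)%:R%R)^-1 * path_elt k').
  rewrite -e1.
  have p1 : para (star V) ((path_elt k.+1)^-1 * path_elt k').
    rewrite path_eltS invgM -mulgA paraMl //; apply: paraV; apply: para_word.
    by rewrite /= tk star_refl.
  have p2 : para (fun j => (j != V) && (j != (V + 1)%R)) ((path_elt k.+1)^-1 * path_elt k').
    apply: path_para => [|j jk]; first by case/andP: kk'.
    by rewrite tagVS ?andbT; [apply/eqP/between|]; lia.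
  apply: sub_para (paraI p1 p2) => j /= /and3P[Vj nVj nVSj]; apply/edgeP; left.
  move: Vj; rewrite /star eq_sym (negbTE nVj) /adjz (negbTE nVSj) /= -BV.
  by move=> /eqP/addIr.
have : c ((k./2)%:R + 1)%R = c ((k'./2)%:R + 1)%R.
  have eB : t ((k./2)%:R + 1)%R = B by apply: tB => //; lia.
  have eB' : t ((k'./2)%:R + 1)%R = B by apply: tB => //; lia.
  rewrite (cSh (k'./2)%:R%R) ch eB eB'; apply/(X_mk_eq hn ntG); split=> //.
  rewrite natr1 -(mulgK (cyc_class [:: l (k'./2)%:R%R]) (h (k'./2)%:R%R)) -e2 mulgA.
  apply: paraM => //; apply: paraV; apply: para_word; rewrite /= andbT tl eB'.
  by apply/edgeP; left.
move=> /inj_c /addIr; rewrite -[X in X = _]add0r -[X in _ = X]add0r => /natrZ_inj e.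
have : k./2 = k'./2 by apply: e; lia.
lia.
Qed.

End Cycles.

(** * Embedded n-cycles bound polygons *)

Section Polygons.
Variables (n : nat) (hn : (5 <= n)%N) (G : 'Z_n -> groupType).
Hypothesis ntG : forall i : 'Z_n, exists x : G i, x <> 1.
Local Notation C := (cyclic_product G).
Local Notation Vx := (X_vertex G).

Lemma dihedral_class_shift (V : Type) (f : 'Z_n -> V) k :
  dihedral_class (fun i => f (i + k)%R) = dihedral_class f.
Proof.
apply/seteqP; split=> d [j [dj|dj]].
- by exists (j + k)%R; left=> i; rewrite dj addrA.
- by exists (j + k)%R; right=> i; rewrite dj addrAC.
- by exists (j - k)%R; left=> i; rewrite dj addrA subrK.
- by exists (j - k)%R; right=> i; rewrite dj addrAC subrK.
Qed.

Lemma dihedral_class_reverse (V : Type) (f : 'Z_n -> V) :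
  dihedral_class (fun i => f (- i)%R) = dihedral_class f.
Proof.
apply/seteqP; split=> d [j [dj|dj]].
- by exists (- j)%R; right=> i; rewrite dj opprD addrC.
- by exists (- j)%R; left=> i; rewrite dj opprB.
- by exists (- j)%R; right=> i; rewrite dj opprB opprK.
- by exists (- j)%R; left=> i; rewrite dj opprD opprK addrC.
Qed.

Lemma X_adj_index (v w : Vx) g h i j : v = X_mk g i -> w = X_mk h j -> X_adj v w ->
  (exists x, v = X_mk x i /\ w = X_mk x j) /\ (j = (i + 1)%R \/ i = (j + 1)%R).
Proof.
move=> ev ew [x [k [[ex ey]|[ey ex]]]].
  have [ei _] := (X_mk_eq hn ntG _ _ _ _).1 (esym (etrans (esym ex) ev)).
  have [ej _] := (X_mk_eq hn ntG _ _ _ _).1 (esym (etrans (esym ey) ew)).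
  by rewrite ei ej subrK; split; [exists x | left].
have [ei _] := (X_mk_eq hn ntG _ _ _ _).1 (esym (etrans (esym ex) ev)).
have [ej _] := (X_mk_eq hn ntG _ _ _ _).1 (esym (etrans (esym ey) ew)).
by rewrite ei ej subrK; split; [exists x | right].
Qed.

Lemma cycle_data (c : 'Z_n -> Vx) (t : 'Z_n -> 'Z_n) :
  (forall i, exists g, c i = X_mk g (t i)) -> (forall i, X_adj (c i) (c (i + 1)%R)) ->
  exists (h : 'Z_n -> C) (l m : 'Z_n -> letter G),
    [/\ forall i, c i = X_mk (h i) (t i), forall i, c (i + 1)%R = X_mk (h i) (t (i + 1)%R),
      forall i, tag (l i) = t (i + 1)%R /\ tag (m i) = (t (i + 1) + 1)%R
      & forall i, h (i + 1)%R = h i * (cyc_class [:: l i] * cyc_class [:: m i])].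
Proof.
move=> ct adj_c.
have /choice[h Hh] i : exists x, c i = X_mk x (t i) /\ c (i + 1)%R = X_mk x (t (i + 1)%R).
  have [g eg] := ct i; have [g' eg'] := ct (i + 1)%R.
  by have [] := X_adj_index eg eg' (adj_c i).
have /choice[lm Hlm] i : exists lm : letter G * letter G,
    [/\ tag lm.1 = t (i + 1)%R, tag lm.2 = (t (i + 1) + 1)%R
      & h (i + 1)%R = h i * (cyc_class [:: lm.1] * cyc_class [:: lm.2])].
  have [e1 _] := Hh (i + 1)%R; have [_ e2] := Hh i; rewrite e2 in e1.
  have [_ /edge_mul[x [y exy]]] := (X_mk_eq hn ntG _ _ _ _).1 e1.
  exists (mk_letter x, mk_letter y); split=> //=.
  by rewrite !cyc_in_letter -exy mulVKg.
exists h, (fun i => (lm i).1), (fun i => (lm i).2); split=> i; try by have [] := Hh i.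
  by have [] := Hlm i.
by have [] := Hlm i.
Qed.

Lemma rising_cycle (c : 'Z_n -> Vx) (t : 'Z_n -> 'Z_n) :
  (forall i, exists g, c i = X_mk g (t i)) -> (forall i, X_adj (c i) (c (i + 1)%R)) ->
  (forall i, t (i + 1)%R = (t i + 1)%R) -> exists g, dihedral_class c = X_boundary g.
Proof.
move=> ct adj_c up; have [h [l [m [ch cSh tlm hS]]]] := cycle_data ct adj_c.
have [g cg] := monotone_polygon hn ntG cSh (fun i => (tlm i).1) (fun i => (tlm i).2) hS up.
exists g; rewrite /X_boundary -[RHS](dihedral_class_shift _ (t 0%R)); congr dihedral_class.
have tE (s : nat) : t s%:R%R = (s%:R + t 0)%R.
  by elim: s => [|s IHs]; [rewrite add0r | rewrite -natr1 up IHs addrAC].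
by apply/funext => i; rewrite cg; congr X_mk; have := tE i; rewrite natr_Zp.
Qed.

Lemma cycle_polygon (c : 'Z_n -> Vx) : injective c ->
  (forall i, X_adj (c i) (c (i + 1)%R)) -> exists g, dihedral_class c = X_boundary g.
Proof.
move=> inj_c adj_c.
have /choice[t ct] i : exists u, exists g, c i = X_mk g u.
  by have [g [u e]] := X_vertexP (c i); exists u, g.
have [h [l [m [ch cSh tlm hS]]]] := cycle_data ct adj_c.
have ht i : t (i + 1)%R = (t i + 1)%R \/ t i = (t (i + 1) + 1)%R.
  have [g eg] := ct i; have [g' eg'] := ct (i + 1)%R.
  by have [_] := X_adj_index eg eg' (adj_c i).
have [/(rising_path hn ht)up|/(falling_path hn ht)down|] := height_end hn ht.
- exact: rising_cycle ct adj_c up.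
(* A falling cycle is a rising one read backwards. *)
- rewrite -dihedral_class_reverse; apply: (@rising_cycle _ (fun i => t (- i)%R)).
  + by move=> i; apply: ct.
  + move=> i; apply: X_adj_sym; have := adj_c (- (i + 1))%R.
    by rewrite opprD subrK.
  + by move=> i; rewrite [LHS]down opprD subrK.
- by case/(no_reversal hn ntG ch cSh (fun i => (tlm i).1) (fun i => (tlm i).2) hS ht inj_c).
Qed.
End Polygons.

(** * The isomorphism *)

Lemma inj_surj_bijective (S T : Type) (f : S -> T) :
  injective f -> (forall y, exists x, f x = y) -> bijective f.
Proof.
move=> inj_f /choice[g fK]; exists g => // x; exact/inj_f/fK.
Qed.

Theorem proposition3p2 (n : nat) (hn : (5 <= n)%N) (G : 'Z_n -> groupType)
    (ntG : forall i : 'Z_n, exists x : G i, x <> 1%g) :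
  exists Phi : complex_iso (complexX G) (complexScrX G),
    (forall (g : cyclic_product G) (i : 'Z_n),
       val (vmap Phi (X_mk g i)) = conj_set g (vertex_group G i)) /\
    equivariant (X_action G) (scrX_action G) Phi.
Proof.
(* By [X_mk_eq] the representative g of a coset is unique up to the edge subgroup, whose elements
   normalise it, so the conjugate is well defined. *)
have /choice[f Hf] (v : X_vertex G) : exists H : scrX_vertex G,
    forall g i, v = X_mk g i -> val H = conj_set g (vertex_group G i).
  have [g [i ->]] := X_vertexP v.
  have mH : conj_set g (para (edge i)) \in @C_medium (cyclic_product G).
    by apply/mem_set/C_mediumP => //; exists g, i.
  exists (SigSub mH) => h j /(X_mk_eq hn ntG)[<- igh] /=.
  by rewrite vertex_groupE // -(mulVKg g h) conj_setM (conj_para igh).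
have fE g i : val (f (X_mk g i)) = conj_set g (para (edge i)).
  by rewrite (Hf _ g i erefl) vertex_groupE.
have f_adj v w : scrX_adj (f v) (f w) <-> X_adj v w.
  have [g [i ->]] := X_vertexP v; have [h [j ->]] := X_vertexP w.
  by rewrite /scrX_adj !fE; apply: C_maximal_adj.
have inj_f : injective f.
  move=> v w; have [g [i ->]] := X_vertexP v; have [h [j ->]] := X_vertexP w.
  move=> /(congr1 val); rewrite !fE => /(congr1 (conj_set g^-1)).
  rewrite -!conj_setM mulVg conj_set1 => /esym/(conj_edge_eq hn ntG)[eij igh].
  by apply/X_mk_eq.
have surj_f H : exists v, f v = H.
  have /set_mem/(C_mediumP hn ntG)[g [i def_H]] := valP H.
  by exists (X_mk g i); apply: val_inj; rewrite fE.
have f_vact g v : f (X_vact g v) = scrX_vact g (f v).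
  have [h [i ->]] := X_vertexP v; apply: val_inj.
  by rewrite X_vactE /= !fE conj_setM.
have cycle_f g : dihedral_class (f \o X_mk g) \in @scrX_cycles n G.
  apply/mem_set; exists (f \o X_mk g); split=> //; split.
    by move=> i j /inj_f/(X_mk_eq hn ntG)[].
  move=> i j; rewrite f_adj; split=> [|ij].
    by move=> /(X_adj_index hn ntG erefl erefl)[_].
  by exists g; case: ij => ->; [exists (i + 1)%R; left|exists (j + 1)%R; right]; rewrite addrK.
pose pm g : scrX_polygon G := SigSub (cycle_f g).
have bij_f := inj_surj_bijective inj_f surj_f.
have bij_pm : bijective pm.
  apply: inj_surj_bijective.
    move=> g h /(congr1 val)/= e.
    have : dihedral_class (f \o X_mk g) (f \o X_mk h).
      by rewrite e; exists 0%R; left=> i; rewrite addr0.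
    move=> [k [H|H]].
      (* A rotation must preserve types, so g and h differ by an element lying in all edge
         subgroups; three consecutive ones already meet trivially. *)
      have gh i : para (edge i) (h^-1 * g).
        by have [] := (X_mk_eq hn ntG _ _ _ _).1 (inj_f _ _ (H i)).
      have : para pred0 (h^-1 * g).
        have := paraI (paraI (gh 0%R) (gh (0 + 1)%R)) (gh (0 + 1 + 1)%R).
        apply: sub_para => j /= /andP[/andP[/edgeP[]-> /edgeP e1] /edgeP e2].
          by case: e1 => /esym/eqP; rewrite ?(negbTE (succ_neq _)) ?(negbTE (succ2_neq hn _)).
        by case: e2 => /esym/eqP; rewrite ?(negbTE (succ_neq _)) ?(negbTE (succ2_neq hn _)).
      by move=> /(@para0 _ _ pred0 _ (fun=> isT))/(congr1 (fun x => h * x)); rewrite mulVKg mulg1.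
    (* A reflection would fix every type; the types 0 and 1 already give 2 = 0 in Z/n. *)
    have idx i : i = (k - i)%R by have [] := (X_mk_eq hn ntG _ _ _ _).1 (inj_f _ _ (H i)).
    have := succ2_neq hn 0%R; rewrite add0r {2}(idx 1%R) -(subr0 k) -(idx 0%R) add0r.
    by rewrite subrr eqxx.
  move=> [D HD]; have [d [[inj_d d_adj] def_D]] := set_mem HD.
  have /choice[c fc] i : exists v, f v = d i by apply: surj_f.
  have inj_c : injective c by move=> i j /(congr1 f); rewrite !fc => /inj_d.
  have adj_c i : X_adj (c i) (c (i + 1)%R) by rewrite -f_adj !fc d_adj; left.
  have [g eg] := cycle_polygon hn ntG inj_c adj_c; exists g; apply: val_inj.
  rewrite /= def_D -(dihedral_class_map f) -/(X_boundary g) -eg dihedral_class_map.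
  by congr dihedral_class; apply/funext => i; rewrite /= fc.
have bd_pm p : @boundary n (complexScrX G) (pm p) =
    [set f \o c | c in @boundary n (complexX G) p].
  by rewrite /= dihedral_class_map.
exists (@ComplexIso n (complexX G) (complexScrX G) f pm bij_f bij_pm f_adj bd_pm).
split=> [g i|]; first exact: Hf.
split=> [g v|g p]; first exact: f_vact.
apply: val_inj; rewrite /= dihedral_class_map; congr dihedral_class.
by apply/funext => i; rewrite /= -f_vact X_vactE.
Qed.
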